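(* Let $f_*$ be the optimal value of problem $(\mathcal{P})$ and suppose that: (1) $f$, $F$, and $g_i$, $i\in M$, are twice continuously Fréchet differentiable on $\Omega$, $\phi$ is continuously differentiable on its effective domain, and $\phi'(0)>0$; (2) the function $(x,\lambda,\mu)\mapsto\mathcal{L}(x,\lambda,\mu,c)$ is weakly sequentially lower semicontinuous for all $c>0$; (3) the set $\Omega_r(f_*+\varepsilon)=\{x\in\Omega\mid f(x)+r(\|F(x)\|^2+|\max\{g(x),0\}|^2)\le f_*+\varepsilon\}$ is bounded for some $r>0$ and $\varepsilon>0$; (4) the functions $f$, $g_i$, $i\in M$, and $F$, as well as their first and second order Fréchet derivatives, are bounded on $\Omega_r(f_*+\varepsilon)$; (5) the constraints of the problem $(\mathcal{P})$ satisfy the Palais–Smale condition; (6) the function $Q(x)[\cdot]$ is positive definite at every globally optimal solution $x$ of the problem $(\mathcal{P})$. Then the augmented Lagrangian $\mathcal{L}(x,\lambda,\mu,c)$ is globally exact.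
   Context: Setting. $X$ and $H$ are real Hilbert spaces, $M=\{1,\dots,m\}$, and $f,g_i\colon X\to\mathbb{R}$ ($i\in M$), $F\colon X\to H$ are continuously Fréchet differentiable; $g=(g_1,\dots,g_m)$. Problem $(\mathcal{P})$: minimise $f(x)$ subject to $F(x)=0$, $g_i(x)\le 0$, $i\in M$. It is assumed that $(\mathcal{P})$ has a globally optimal solution. $|\cdot|$ is the Euclidean norm; $\max\{y,z\}$ of vectors is taken coordinatewise; $\nabla g(x)y\in\mathbb{R}^m$ is the vector with coordinates $\langle\nabla g_i(x),y\rangle$; $DF(x)[\cdot]\colon X\to H$ is the Fréchet derivative, $DF(x)^*$ its adjoint; $\mathrm{diag}(\cdot)$ is the diagonal matrix. Product spaces carry the Hilbert product norm. The function $\phi\colon[0,+\infty)\to[0,+\infty]$ is convex, non-decreasing, lower semicontinuous, $\phi(t)=0$ iff $t=0$, $\mathrm{dom}\,\phi\ne\{0\}$, and either $\mathrm{dom}\,\phi=[0,+\infty)$ and $\phi(t)\to+\infty$ as $t\to\infty$, or $\mathrm{dom}\,\phi=[0,\alpha)$ for some $\alpha>0$ and $\phi(t)\to+\infty$ as $t\to\alpha$. The function $\psi\colon[0,+\infty)^m\to\mathbb{R}$ is continuously differentiable and concave, $\psi(0)>0$, $0$ is a global maximum point of $\psi$, and $\frac{\partial\psi}{\partial y_i}(y)=0$ whenever $y\in[0,+\infty)^m$, $y_i=0$. Put $b(x)=\psi(\max\{g(x),0\})$, $p(x,\mu)=b(x)/(1+|\mu|^2)$, $\Omega=\{x\in X\mid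 b(x)>0,\ \phi(\|F(x)\|^2)<+\infty\}$, $L(x,\lambda,\mu)=f(x)+\langle\lambda,F(x)\rangle+\langle\mu,g(x)\rangle$ for $\lambda\in H$, $\mu\in\mathbb{R}^m$, and $$\eta(x,\lambda,\mu)=\tfrac12\big\|DF(x)[\nabla_xL(x,\lambda,\mu)]\big\|^2+\tfrac12\sum_{i=1}^m\big(\langle\nabla g_i(x),\nabla_xL(x,\lambda,\mu)\rangle+g_i(x)^2\mu_i\big)^2.$$ For $c>0$ the augmented Lagrangian is $$\mathcal{L}(x,\lambda,\mu,c)=f(x)+\langle\lambda,F(x)\rangle+\tfrac c2(1+\|\lambda\|^2)\phi(\|F(x)\|^2)+\langle\mu,q\rangle+\tfrac{c}{2p(x,\mu)}|q|^2+\eta(x,\lambda,\mu),\quad q=\max\{g(x),-\tfrac1c p(x,\mu)\mu\},$$ if $x\in\Omega$, and $\mathcal{L}(x,\lambda,\mu,c)=+\infty$ otherwise. Also $$Q(x)[\lambda,\mu]=\tfrac12\Big\|DF(x)\Big[DF(x)^*[\lambda]+\sum_{i=1}^m\mu_i\nabla g_i(x)\Big]\Big\|^2+\tfrac12\Big|\nabla g(x)\Big(DF(x)^*[\lambda]+\sum_{i=1}^m\mu_i\nabla g_i(x)\Big)+\mathrm{diag}(g_i(x)^2)\mu\Big|^2.$$ $Q(x)[\cdot]$ is positive definite at $x$ if there is $a>0$ with $Q(x)[\lambda,\mu]\ge a(\|\lambda\|^2+|\mu|^2)$ for all $\lambda\in H,\mu\in\mathbb{R}^m$. Denote $a_{\max}(Q(x))=\inf\{Q(x)[\lambda,\mu]\mid\|(\lambda,\mu)\|=1\}$.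 The constraints of $(\mathcal{P})$ satisfy the Palais–Smale condition if every bounded sequence $\{x_n\}\subset X$ such that $\|F(x_n)\|+|\max\{g(x_n),0\}|\to0$ and $a_{\max}(Q(x_n))\to0$ as $n\to\infty$ has a (norm) convergent subsequence. A triplet $(x_*,\lambda_*,\mu_* )\in X\times H\times\mathbb{R}^m$ is a KKT-point of $(\mathcal{P})$ if $\nabla_xL(x_*,\lambda_*,\mu_* )=0$, $F(x_* )=0$, $\max\{g(x_* ),-\mu_*\}=0$. Standing assumption: for every globally optimal solution $x_*$ of $(\mathcal{P})$ there exist $\lambda_*,\mu_*$ such that $(x_*,\lambda_*,\mu_* )$ is a KKT-point. The augmented Lagrangian is called globally exact if there exists $c_*>0$ such that for all $c\ge c_*$ a triplet $(x_*,\lambda_*,\mu_* )$ is a global minimiser of $\mathcal{L}(\cdot,c)$ over $X\times H\times\mathbb{R}^m$ if and only if $x_*$ is a globally optimal solution of $(\mathcal{P})$ and $(x_*,\lambda_*,\mu_* )$ is a KKT-point of $(\mathcal{P})$. *)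

(* Defs.v *)
From HB Require Import structures.
From mathcomp Require Import all_boot all_order all_algebra.
From mathcomp Require Import all_classical all_reals all_analysis.

Set Implicit Arguments.
Unset Strict Implicit.
Unset Printing Implicit Defensive.
Import Order.TTheory GRing.Theory Num.Theory.
Import numFieldNormedType.Exports.
Local Open Scope classical_set_scope.
Local Open Scope ring_scope.

HB.mixin Record hasInnerProduct (R : realType) X
    of CompleteNormedModule R X := {
  inner : X -> X -> R ;
  innerC : forall x y, inner x y = inner y x ;
  innerDl : forall x y z, inner (x + y) z = inner x z + inner y z ;
  innerZl : forall (a : R) x y, inner (a *: x) y = a * inner x y ;
  inner_norm : forall x, inner x x = `|x| ^+ 2
}.

#[short(type="hilbertType")]
HB.structure Definition Hilbert (R : realType) :=
  {X of CompleteNormedModule R X & hasInnerProduct R X}.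

Section Calculus.
Variables (R : realType).

(* [op_le T C] says that the operator norm of the linear map T is at most C;
   [bop_le] is its analogue for bilinear maps, identified with elements of
   L(X, L(X, Y)). *)
Definition op_le (X Y : normedModType R) (T : X -> Y) (C : R) : Prop :=
  forall h, `|T h| <= C * `|h|.

Definition bop_le (X Y : normedModType R) (B : X -> X -> Y) (C : R) : Prop :=
  forall h k, `|B h k| <= C * `|h| * `|k|.

Definition C1 (X Y : normedModType R) (F : X -> Y) : Prop :=
  (forall x, differentiable F x) /\
  forall x (e : R), 0 < e ->
    \forall y \near x, op_le (fun h => 'd F y h - 'd F x h) e.

(* B is the derivative at x of y |-> 'd F y, a map into the bounded linear
   operators with the operator norm. *)
Definition is_diff2 (X Y : normedModType R) (F : X -> Y) (x : X)
    (B : X -> X -> Y) : Prop :=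
  [/\ \forall y \near x, differentiable F y,
      (forall h, linear (B h)) /\ (forall k, linear (B^~ k)),
      exists C, bop_le B C &
      forall e : R, 0 < e -> \forall y \near x,
        op_le (fun k => 'd F y k - 'd F x k - B (y - x) k) (e * `|y - x|)].

Definition diff2 (X Y : normedModType R) (F : X -> Y) (x : X) : X -> X -> Y :=
  get (is_diff2 F x).

Definition C2_on (X Y : normedModType R) (A : set X) (F : X -> Y) : Prop :=
  (forall x, A x -> is_diff2 F x (diff2 F x)) /\
  forall x, A x -> forall e : R, 0 < e ->
    \forall y \near within A (nbhs x),
      bop_le (fun h k => diff2 F y h k - diff2 F x h k) e.

Definition bounded2_on (X Y : normedModType R) (A : set X) (F : X -> Y) : Prop :=
  exists C : R, forall x, A x ->
    [/\ `|F x| <= C, op_le ('d F x) C & bop_le (diff2 F x) C].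

Definition grad (X : hilbertType R) (f : X -> R) (x : X) : X :=
  get [set v | forall h, 'd f x h = inner v h].

Definition adjoint (X H : hilbertType R) (T : X -> H) (y : H) : X :=
  get [set v | forall x, inner (T x) y = inner x v].

Definition weak_cvg (V : normedModType R) (u : nat -> V) (l : V) : Prop :=
  forall T : {linear V -> R^o}, continuous T -> T (u n) @[n --> \oo] --> T l.

Definition weakly_seq_lsc (V : normedModType R) (G : V -> \bar R) : Prop :=
  forall (u : nat -> V) (l : V), weak_cvg u l ->
    (G l <= limn_einf (fun n => G (u n)))%E.

(* R^m is 'rV[R]_m; the library's norm there is the max norm, so the Euclidean
   structure is given separately. *)
Definition vdot m (u v : 'rV[R]_m) : R := \sum_i u 0 i * v 0 i.
Definition enorm m (u : 'rV[R]_m) : R := Num.sqrt (vdot u u).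

End Calculus.

Section Penalties.
Variables (R : realType).

(* phi is only constrained on [0, +oo[, psi only on the nonnegative orthant;
   their values elsewhere are irrelevant. *)
Definition edom (phi : R -> \bar R) : set R :=
  [set t | 0 <= t /\ (phi t < +oo)%E].

Record phi_admissible (phi : R -> \bar R) : Prop := {
  phi_ge0 : forall t : R, 0 <= t -> (0 <= phi t)%E ;
  phi_convex : forall s t a : R, 0 <= s -> 0 <= t -> 0 <= a <= 1 ->
    (phi (a * s + (1 - a) * t)%R <= a%:E * phi s + (1 - a)%:E * phi t)%E ;
  phi_nondecreasing : forall s t : R, 0 <= s -> s <= t -> (phi s <= phi t)%E ;
  phi_lsc : lower_semicontinuous (phi : subspace `[0, +oo[%classic -> \bar R) ;
  phi_eq0 : forall t : R, 0 <= t -> (phi t = 0%E <-> t = 0) ;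
  phi_dom : edom phi <> [set 0] ;
  phi_coercive :
    (edom phi = `[0, +oo[%classic /\ phi t @[t --> +oo] --> +oo%E) \/
    (exists2 a : R, 0 < a &
       edom phi = `[0, a[%classic /\ phi t @[t --> a^'-] --> +oo%E) }.

(* The derivative is relative to the effective domain, hence the right
   derivative at 0. *)
Definition phi_smooth (phi : R -> \bar R) : Prop :=
  exists dphi : R -> R,
    [/\ forall t : R, edom phi t ->
          (fine (phi s) - fine (phi t)) / (s - t)
            @[s --> within (edom phi `\ t) (nbhs t)] --> dphi t,
        {within edom phi, continuous dphi} &
        0 < dphi 0].

Definition orthant m : set 'rV[R]_m := [set y | forall i, 0 <= y 0 i].

(* Continuous differentiability on the closed orthant, derivatives at boundary
   points being relative to the orthant; [dpsi y] is the vector of partial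
   derivatives of psi at y. *)
Definition is_grad_orthant m (psi : 'rV[R]_m -> R) (dpsi : 'rV[R]_m -> 'rV[R]_m)
    : Prop :=
  (forall y, orthant y -> forall e : R, 0 < e ->
     \forall z \near within (@orthant m) (nbhs y),
       `|psi z - psi y - vdot (dpsi y) (z - y)| <= e * enorm (z - y)) /\
  {within @orthant m, continuous dpsi}.

Record psi_admissible m (psi : 'rV[R]_m -> R) : Prop := {
  psi_C1 : exists2 dpsi, is_grad_orthant psi dpsi &
    forall y i, orthant y -> y 0 i = 0 -> dpsi y 0 i = 0 ;
  psi_concave : forall y z (a : R), orthant y -> orthant z -> 0 <= a <= 1 ->
    a * psi y + (1 - a) * psi z <= psi (a *: y + (1 - a) *: z) ;
  psi0_gt0 : 0 < psi 0 ;
  psi_max0 : forall y, orthant y -> psi y <= psi 0 }.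

End Penalties.

Section Problem.
Variables (R : realType) (X H : hilbertType R) (m : nat).
Variables (f : X -> R) (F : X -> H) (g : 'I_m -> X -> R).

Definition gpos (x : X) : 'rV[R]_m := \row_i Num.max (g i x) 0.

Definition feasible : set X := [set x | F x = 0 /\ forall i, g i x <= 0].

Definition global_sol (x : X) : Prop :=
  feasible x /\ forall y, feasible y -> f x <= f y.

Definition optval : R := inf [set f x | x in feasible].

Definition Lag (x : X) (lam : H) (mu : 'rV[R]_m) : R :=
  f x + inner lam (F x) + \sum_i mu 0 i * g i x.

Definition gradL (x : X) (lam : H) (mu : 'rV[R]_m) : X :=
  grad (fun y => Lag y lam mu) x.

Definition KKT (x : X) (lam : H) (mu : 'rV[R]_m) : Prop :=
  [/\ gradL x lam mu = 0, F x = 0 & forall i, Num.max (g i x) (- mu 0 i) = 0].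

Definition gradg (x y : X) : 'rV[R]_m := \row_i inner (grad (g i) x) y.

Definition eta (x : X) (lam : H) (mu : 'rV[R]_m) : R :=
  2^-1 * `|'d F x (gradL x lam mu)| ^+ 2 +
  2^-1 * \sum_i (inner (grad (g i) x) (gradL x lam mu)
                 + g i x ^+ 2 * mu 0 i) ^+ 2.

Definition Q (x : X) (lam : H) (mu : 'rV[R]_m) : R :=
  let w := adjoint ('d F x) lam + \sum_i mu 0 i *: grad (g i) x in
  2^-1 * `|'d F x w| ^+ 2 +
  2^-1 * enorm (gradg x w + mu *m diag_mx (\row_i g i x ^+ 2)) ^+ 2.

Definition Q_posdef (x : X) : Prop :=
  exists2 a : R, 0 < a &
    forall lam mu, a * (`|lam| ^+ 2 + enorm mu ^+ 2) <= Q x lam mu.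

(* Taken in \bar R so that the infimum over an empty sphere (H trivial and
   m = 0) is +oo. *)
Definition amaxQ (x : X) : \bar R :=
  ereal_inf [set e | exists lam mu,
    Num.sqrt (`|lam| ^+ 2 + enorm mu ^+ 2) = 1 /\ e = (Q x lam mu)%:E].

Definition Palais_Smale : Prop :=
  forall u : nat -> X, bounded_fun u ->
    `|F (u n)| + enorm (gpos (u n)) @[n --> \oo] --> (0 : R) ->
    amaxQ (u n) @[n --> \oo] --> 0%E ->
    exists2 k : nat -> nat, {homo k : i j / (i < j)%N} & cvgn (u \o k).

Variables (phi : R -> \bar R) (psi : 'rV[R]_m -> R).

Definition bfun (x : X) : R := psi (gpos x).

Definition pfun (x : X) (mu : 'rV[R]_m) : R := bfun x / (1 + enorm mu ^+ 2).

Definition Omega : set X :=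
  [set x | 0 < bfun x /\ (phi (`|F x| ^+ 2)%R < +oo)%E].

Definition Omega_r (r v : R) : set X :=
  [set x | Omega x /\ f x + r * (`|F x| ^+ 2 + enorm (gpos x) ^+ 2) <= v].

Definition qvec (x : X) (mu : 'rV[R]_m) (c : R) : 'rV[R]_m :=
  \row_i Num.max (g i x) (- (c^-1 * pfun x mu * mu 0 i)).

Definition AL (x : X) (lam : H) (mu : 'rV[R]_m) (c : R) : \bar R :=
  if `[< Omega x >] then
    (f x + inner lam (F x)
     + c / 2 * (1 + `|lam| ^+ 2) * fine (phi (`|F x| ^+ 2))
     + vdot mu (qvec x mu c)
     + c / (2 * pfun x mu) * enorm (qvec x mu c) ^+ 2
     + eta x lam mu)%:E
  else +oo%E.

(* The library norm on this product is the max norm, equivalent to the Hilbert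
   product norm, so the continuous functionals in [weak_cvg] are the same. *)
Definition AL_triplet (c : R) (z : X * H * 'rV[R]_m) : \bar R :=
  AL z.1.1 z.1.2 z.2 c.

Definition globally_exact : Prop :=
  exists2 c0 : R, 0 < c0 & forall c, c0 <= c ->
    forall x lam mu,
      (forall x' lam' mu', (AL x lam mu c <= AL x' lam' mu' c)%E) <->
      (global_sol x /\ KKT x lam mu).

End Problem.

(* Main.v *)
Require Import Defs.
From HB Require Import structures.
From mathcomp Require Import all_boot all_order all_algebra.
From mathcomp Require Import all_classical all_reals all_analysis.
From mathcomp Require Import ring lra.

Set Implicit Arguments.
Unset Strict Implicit.
Unset Printing Implicit Defensive.
Import Order.TTheory GRing.Theory Num.Theory.
Import numFieldNormedType.Exports.
Local Open Scope classical_set_scope.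
Local Open Scope ring_scope.

(** Put [A = (DF(x), grad g(x))], [B = A A^* + diag(0, g(x)^2)] on [H x R^m]; then
    [Q(x)[xi] = |B xi|^2 / 2] and [eta = |A grad_x L + diag(g^2) mu|^2 / 2].
    It suffices to show that for large [c] every point with value at most [f_*]
    is a global solution together with its multipliers.

    For large [c] such a point lies in the bounded set of (3), is almost
    feasible and almost optimal.  There the Palais-Smale condition and positive
    definiteness at the solutions give a uniform lower bound for [B], whence
    bounded multipliers.  With [s = q - g >= 0], the equations [F(x') = 0],
    [g(x') + max(s + g(x)^2 nu, 0) = 0] in [x' = x + A^* (zeta, nu)] have
    linearisation [B] at [0], so an iteration produces a feasible [x'] with
    [|(zeta, nu)| = O(delta)], [delta = |(F(x), q)|].  Since [x' - x] is in the
    range of [A^*], the first-order term in [f(x') >= f_*] is controlled by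
    [delta sqrt(eta)], and the quadratic penalty absorbs the rest:
    the augmented Lagrangian is at least [f_* + eta / 2 + delta^2].  Hence
    [eta = delta = 0], and the injectivity of [B] identifies the multipliers. *)

(** * Semidefinite forms and the Cauchy-Schwarz inequality *)

Record inner_form (R : realType) (V : lmodType R) (ip : V -> V -> R) : Prop := {
  ipC : forall u v, ip u v = ip v u ;
  ipDl : forall u v w, ip (u + v) w = ip u w + ip v w ;
  ipZl : forall a u v, ip (a *: u) v = a * ip u v ;
  ip_ge0 : forall u, 0 <= ip u u }.

(** The norm is built from the form because the library norms on ['rV[R]_m] and on products are max
    norms; [enorm] and [pnorm] are instances. *)
Definition ipn (R : realType) (V : lmodType R) (ip : V -> V -> R) (u : V) : R :=
  Num.sqrt (ip u u).

Section InnerForm.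
Variables (R : realType) (V : lmodType R) (ip : V -> V -> R).
Hypothesis ipP : inner_form ip.
Local Notation N := (ipn ip).

Lemma ipDr u v w : ip u (v + w) = ip u v + ip u w.
Proof. by rewrite !(ipC ipP u) (ipDl ipP). Qed.

Lemma ipZr a u v : ip u (a *: v) = a * ip u v.
Proof. by rewrite !(ipC ipP u) (ipZl ipP). Qed.

Lemma ipNl u v : ip (- u) v = - ip u v.
Proof. by rewrite -scaleN1r (ipZl ipP) mulN1r. Qed.

Lemma ipNr u v : ip u (- v) = - ip u v.
Proof. by rewrite -scaleN1r ipZr mulN1r. Qed.

Lemma ipBl u v w : ip (u - v) w = ip u w - ip v w.
Proof. by rewrite (ipDl ipP) ipNl. Qed.

Lemma ipBr u v w : ip u (v - w) = ip u v - ip u w.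
Proof. by rewrite ipDr ipNr. Qed.

Lemma ip0l v : ip 0 v = 0.
Proof. by rewrite -(scale0r v) (ipZl ipP) mul0r. Qed.

Lemma ipn_ge0 u : 0 <= N u.
Proof. exact: sqrtr_ge0. Qed.

Lemma ipn_sqr u : N u ^+ 2 = ip u u.
Proof. by rewrite sqr_sqrtr ?(ip_ge0 ipP). Qed.

Lemma ipn0 : N 0 = 0.
Proof. by rewrite /ipn ip0l sqrtr0. Qed.

Lemma ipnN u : N (- u) = N u.
Proof. by rewrite /ipn ipNl ipNr opprK. Qed.

Lemma ipnZ a u : N (a *: u) = `|a| * N u.
Proof.
by rewrite /ipn (ipZl ipP) ipZr mulrA -expr2 sqrtrM ?sqr_ge0// sqrtr_sqr.
Qed.

Lemma ipn_distC u v : N (u - v) = N (v - u).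
Proof. by rewrite -ipnN opprB. Qed.

Lemma ip_CS u v : `|ip u v| <= N u * N v.
Proof.
have key a b : 0 <= a ^+ 2 * ip u u + 2 * (a * b * ip u v) + b ^+ 2 * ip v v.
  have := ip_ge0 ipP (a *: u + b *: v).
  rewrite (ipDl ipP) !ipDr !(ipZl ipP) !ipZr (ipC ipP v u) => h.
  by apply: le_trans h _; lra.
have h : ip u v ^+ 2 <= ip u u * ip v v.
  have [v0|v0] := eqVneq (ip v v) 0.
    rewrite v0 mulr0; have [->|x0] := eqVneq (ip u v) 0; first by rewrite expr0n.
    (* Here [v] may be nonzero, so [u] is shifted by the multiple of [v] at which the quadratic
       would equal [- ip u u - 2]. *)
    have := key 1 (- (ip u u + 1) / ip u v); rewrite v0.
    have -> : 1 * (- (ip u u + 1) / ip u v) * ip u v = - (ip u u + 1).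
      by field.
    by have := ip_ge0 ipP u; lra.
  have v1 : 0 < ip v v by rewrite lt_def v0 (ip_ge0 ipP).
  have := key (ip v v) (- ip u v).
  have -> : ip v v ^+ 2 * ip u u + 2 * (ip v v * - ip u v * ip u v)
    + (- ip u v) ^+ 2 * ip v v = ip v v * (ip u u * ip v v - ip u v ^+ 2) by ring.
  by rewrite pmulr_rge0// subr_ge0.
rewrite -sqrtr_sqr -sqrtrM ?(ip_ge0 ipP)//; exact: ler_wsqrtr.
Qed.

Lemma ip_le u v : ip u v <= N u * N v.
Proof. exact: le_trans (ler_norm _) (ip_CS u v). Qed.

Lemma ipn_triangle u v : N (u + v) <= N u + N v.
Proof.
rewrite -(@ler_pXn2r _ 2)// ?nnegrE ?addr_ge0 ?ipn_ge0//.
rewrite ipn_sqr sqrrD !ipn_sqr (ipDl ipP) !ipDr (ipC ipP v u).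
have := ip_le u v; lra.
Qed.

Lemma ipn_triangleB u v : N (u - v) <= N u + N v.
Proof. by rewrite -(ipnN v) ipn_triangle. Qed.

End InnerForm.

(** * Hilbert spaces, Riesz representation, and growth of functions along segments *)

Section Hilbert.
Variables (R : realType).
Implicit Types X H : hilbertType R.

Lemma inner_formP X : inner_form (@inner R X).
Proof.
split; [exact: innerC|exact: innerDl|exact: innerZl|].
by move=> u; rewrite inner_norm sqr_ge0.
Qed.

Lemma ipn_norm X (x : X) : ipn (@inner R X) x = `|x|.
Proof. by rewrite /ipn inner_norm sqrtr_sqr normr_id. Qed.

Lemma inner_CS X (x y : X) : `|inner x y| <= `|x| * `|y|.
Proof. by rewrite -!ipn_norm; exact: (ip_CS (inner_formP X)). Qed.

Lemma inner_inj X (x y : X) : (forall h, inner x h = inner y h) -> x = y.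
Proof.
move=> h; apply/eqP; rewrite -subr_eq0 -normr_eq0 -sqrf_eq0.
by rewrite -inner_norm (ipBl (inner_formP X)) h subrr.
Qed.

End Hilbert.

Lemma geometric_cvg (R : realType) (V : completeNormedModType R) (u : nat -> V)
    (A k : R) : 0 <= k < 1 -> (forall n, `|u n.+1 - u n| <= A * k ^+ n) ->
  cvgn u.
Proof.
move=> /andP[k0 k1] uk.
have ct : cvgn (series (telescope u)).
  apply: normed_cvg; apply: (@series_le_cvg R _ (geometric A k)) => [n|n|n|].
  - exact: normr_ge0.
  - exact: le_trans (normr_ge0 _) (uk n).
  - exact: uk.
  - by apply: is_cvg_geometric_series; rewrite ger0_norm.
have /funext uE n : u n = (cst (u 0%N) \+ series (telescope u)) n.
  exact: eq_sum_telescope.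
by rewrite uE; apply: is_cvgD => //; exact: is_cvg_cst.
Qed.

Section Riesz.
Variables (R : realType) (X : hilbertType R) (T : X -> R) (C : R).
Hypothesis TD : forall x y, T (x + y) = T x + T y.
Hypothesis TZ : forall a x, T (a *: x) = a * T x.
Hypothesis Tb : forall x, `|T x| <= C * `|x|.

Let J (h : X) : R := `|h| ^+ 2 - 2 * T h.
Let ipX := inner_formP X.

Let JD l h : J (l + h) = J l + 2 * (inner l h - T h) + `|h| ^+ 2.
Proof.
rewrite /J -!inner_norm TD innerDl !(ipDr ipX) (innerC h l); ring.
Qed.

Let J_mid u v : `|u - v| ^+ 2 = 2 * J u + 2 * J v - 4 * J (2^-1 *: (u + v)).
Proof.
rewrite /J -!inner_norm TZ TD innerZl (ipZr ipX) (ipBl ipX) !(ipBr ipX).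
by rewrite !innerDl !(ipDr ipX) (innerC v u); field.
Qed.

(** The minimiser of [J h = |h|^2 - 2 T h] represents [T]: [J] is bounded below by [- C^2], the
    parallelogram identity [J_mid] makes a minimising sequence Cauchy, and the first variation
    vanishes at its limit. *)
Lemma riesz : exists v, forall h, T h = inner v h.
Proof.
have lb h : - C ^+ 2 <= J h.
  have := Tb h; rewrite ler_norml => /andP[_ h1].
  rewrite /J; have := sqr_ge0 (`|h| - C); nra.
have I_has : has_inf (range J).
  by split; [exists (J 0), 0 | exists (- C ^+ 2) => _ [h _ <-]].
pose I := inf (range J).
have I_lb h : I <= J h by apply: ge_inf; [exact: I_has.2|exists h].
(* With precision [4^-n] the identity [J_mid] bounds the squared distance of consecutive terms by
   [5/2 * 4^-n], hence the distance by [2 * 2^-n]. *)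
have /choice[u uP] (n : nat) : exists x : X, J x <= I + 4^-1 ^+ n.
  have e0 : 0 < (4^-1 : R) ^+ n by rewrite exprn_gt0.
  by have [_ [h _ <-] /ltW hI] := inf_adherent e0 I_has; exists h.
have cu : cvgn u.
  apply: (@geometric_cvg _ _ _ 2 2^-1) => [|n].
    by apply/andP; split; lra.
  rewrite -(@ler_pXn2r _ 2)// ?nnegrE//.
  rewrite J_mid exprMn -exprM mulnC exprM.
  have -> : (2^-1 : R) ^+ 2 = 4^-1 by field.
  have := I_lb (2^-1 *: (u n.+1 + u n)); have := uP n; have := uP n.+1.
  rewrite exprS.
  have : 0 <= (4^-1 : R) ^+ n by rewrite exprn_ge0.
  lra.
have Tc (v : nat -> X) (l : X) : v n @[n --> \oo] --> l ->
    T (v n) @[n --> \oo] --> T l.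
  move=> vl; apply/cvgrPdist_lt => e e0.
  have e1 : 0 < e / (`|C| + 1) by rewrite divr_gt0 ?ltr_wpDl.
  have /cvgrPdist_lt/(_ _ e1) := vl; apply: filterS => n.
  rewrite ltr_pdivlMr ?ltr_wpDl// => h; apply: le_lt_trans h.
  have -> : T l - T (v n) = T (l - v n).
    by rewrite TD -(scaleN1r (v n)) TZ mulN1r.
  apply: le_trans (Tb _) _; rewrite mulrC; apply: ler_wpM2l => //.
  have := ler_norm C; lra.
pose l := limn u.
have Jl : J l <= I.
  have cJ : J (u n) @[n --> \oo] --> J l.
    apply: cvgB; last by apply: cvgMr; exact: Tc.
    by rewrite expr2; apply: cvgM; apply: cvg_norm.
  have cI : I + (4^-1 : R) ^+ n @[n --> \oo] --> I.
    rewrite -[X in _ --> X]addr0; apply: cvgD; first exact: cvg_cst.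
    by apply: cvg_expr; rewrite ger0_norm; lra.
  by apply: (ler_cvg_to cJ cI); apply: nearW.
exists l => h; apply/eqP; rewrite eq_sym -subr_eq0; apply/eqP.
set d := inner l h - T h.
(* A quadratic in [t] that is nonnegative everywhere and vanishes at [0] has no linear term; this is
   tested at its minimum [t = - d / |h|^2], or at [t = - d] when [h = 0]. *)
have key t : 0 <= 2 * t * d + t ^+ 2 * `|h| ^+ 2.
  have := le_trans Jl (I_lb (l + t *: h)).
  by rewrite JD (ipZr ipX) TZ normrZ exprMn -normrX ger0_norm ?sqr_ge0// /d; lra.
have [h0|h0] := eqVneq `|h| 0.
  move: (key (- d)); rewrite h0; have := sqr_ge0 d.
  by rewrite expr0n mulr0 => d0 d1; apply/eqP; rewrite -sqrf_eq0 eq_le d0 andbT; nra.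
have h1 : 0 < `|h| ^+ 2 by rewrite exprn_gt0// lt_def h0 normr_ge0.
move: (key (- d / `|h| ^+ 2)).
have -> : 2 * (- d / `|h| ^+ 2) * d + (- d / `|h| ^+ 2) ^+ 2 * `|h| ^+ 2
   = - (d ^+ 2) / `|h| ^+ 2 by field.
rewrite pmulr_lge0 ?invr_gt0// oppr_ge0 => d0.
by apply/eqP; rewrite -sqrf_eq0 eq_le d0 sqr_ge0.
Qed.

End Riesz.

(** A mean value inequality without integration. Local growth is asked only where the bound already
    holds, so the lemma applies with derivative bounds known only in the region that the bound
    itself guarantees. *)
Lemma segment_growth (R : realType) (X : normedModType R) (u : X -> R)
    (x h : X) (M : R) : continuous u -> u x <= 0 ->
  (forall t, 0 <= t <= 1 -> u (x + t *: h) <= M * (t * `|h|) ->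
     \forall z \near x + t *: h,
       u z <= u (x + t *: h) + M * `|z - (x + t *: h)|) ->
  forall t, 0 <= t <= 1 -> u (x + t *: h) <= M * (t * `|h|).
Proof.
move=> cu ux loc.
pose v t := u (x + t *: h) - M * (t * `|h|).
suff main : forall t, 0 <= t <= 1 -> v t <= 0.
  by move=> t /main; rewrite /v subr_le0.
have cl : continuous (fun t : R => x + t *: h).
  move=> s; apply: cvgD; first exact: cvg_cst.
  by apply: cvgZl; exact: cvg_id.
have cv : continuous v.
  move=> s; apply: cvgB; last first.
    by apply: cvgMr; apply: cvgMl; exact: cvg_id.
  exact: (@continuous_comp _ _ _ (fun t : R => x + t *: h) u s (cl s) (cu _)).
have v0 : v 0 <= 0 by rewrite /v scale0r addr0 mul0r mulr0 subr0.
(* Continuation: the supremum [T] of [S] belongs to [S] by continuity, and if [T < 1] the local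
   estimate at [T] puts the larger time [t] into [S]. *)
pose S := [set t : R | 0 <= t <= 1 /\ forall s, 0 <= s <= t -> v s <= 0].
have S0 : S 0.
  split; first by rewrite lexx ler01.
  by move=> s /andP[s0 s1]; have -> : s = 0 by apply/le_anti; rewrite s1.
have S1 : ubound S 1 by move=> s [/andP[]].
have hS : has_sup S by split; [exists 0|exists 1].
set T := sup S.
have T0 : 0 <= T by apply: ub_le_sup => //; exists 1.
have T1 : T <= 1 by apply: ge_sup => //; exists 0.
have ltT s : 0 <= s < T -> v s <= 0.
  move=> /andP[s0 sT]; have d0 : 0 < T - s by rewrite subr_gt0.
  have [t [_ ht]] := sup_adherent d0 hS; rewrite -/T opprB addrC subrK => st.
  by apply: ht; rewrite s0 ltW.
have vT : v T <= 0.
  rewrite leNgt; apply/negP => vT.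
  have := cv T; move/cvgrPdist_lt/(_ _ vT)/nbhs_ballP => [e /= e0 he].
  have [T00|TN0] := eqVneq T 0; first by move: vT; rewrite T00 ltNge v0.
  have Tp : 0 < T by rewrite lt_def TN0.
  have [s [s0 sT se]] : exists s, [/\ 0 <= s, s < T & T - s < e].
    have [eT|eT] := leP (e / 2) T; [exists (T - e / 2)|exists 0]; split; lra.
  have := he s; rewrite /ball /= gtr0_norm ?subr_gt0// => /(_ se).
  by rewrite ltr_distlC => /andP[]; have := ltT s; rewrite s0 sT => /(_ isT); lra.
have leT s : 0 <= s <= T -> v s <= 0.
  move=> /andP[s0]; rewrite le_eqVlt => /orP[/eqP -> //|sT].
  by apply: ltT; rewrite s0.
suff T1' : T = 1 by move=> t ht; apply: leT; rewrite T1'.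
apply/le_anti; rewrite T1/= leNgt; apply/negP => Tlt1.
have := loc T; rewrite T0 T1 => /(_ isT).
have := vT; rewrite {1}/v subr_le0 => uT /(_ uT) locT.
have /nbhs_ballP[e /= e0 he] := cl T _ locT.
pose t := Num.min 1 (T + e / 2).
have tT : T < t by rewrite lt_min Tlt1; lra.
have : S t.
  split; first by rewrite ge_min lexx ltW// (le_lt_trans T0).
  move=> s /andP[s0 st]; have [sT|Ts] := leP s T; first by apply: leT; rewrite s0.
  have := he s; rewrite /ball /= ltr0_norm ?subr_lt0// opprB => /(_ _)/wrap[].
    by move: st; rewrite le_min => /andP[_]; lra.
  rewrite opprD addrACA subrr add0r -scalerBl normrZ gtr0_norm ?subr_gt0// => h1.
  have := vT; rewrite /v; nra.
move=> /(ub_le_sup hS.2); rewrite -/T leNgt tT.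
by [].
Qed.

(** * Estimates for first and second derivatives *)

Section Differential.
Variables (R : realType) (X Y : normedModType R).
Implicit Types (G : X -> Y) (x h k : X).

Lemma diff_remainder G x : differentiable G x -> forall e : R, 0 < e ->
  \forall z \near x, `|G z - G x - 'd G x (z - x)| <= e * `|z - x|.
Proof.
move=> /diff_locallyP[_ /eqaddoP Gx] e e0.
have /nbhs_ballP[d /= d0 hd] := Gx e e0.
apply/nbhs_ballP; exists d => //= z; rewrite -ball_normE /= distrC => zx.
have := hd (z - x); rewrite -ball_normE /= sub0r normrN => /(_ zx).
rewrite /= -[(_ - _) (z - x)]/(G (z - x + x) - (G x + 'd G x (z - x))).
by rewrite subrK opprD addrA.
Qed.

Lemma diff_op_le G x : differentiable G x ->
  exists2 C : R, 0 < C & op_le ('d G x) C.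
Proof.
move=> /diff_locallyP[/linear_bounded_continuous/linear_boundedP Gb _].
have [C [C0 CP]] := Gb.
exists (`|C| + 1); first by rewrite ltr_wpDl.
by apply: CP; have := ler_norm C; lra.
Qed.

Lemma op_le_lipschitz G x (C : R) : differentiable G x -> op_le ('d G x) C ->
  \forall z \near x, `|G z - G x| <= (C + 1) * `|z - x|.
Proof.
move=> Gx GC; have := diff_remainder Gx ltr01; apply: filterS => z hz.
rewrite -[G z - G x](subrK ('d G x (z - x))).
by apply: le_trans (ler_normD _ _) _; have := GC (z - x); lra.
Qed.

Lemma C1_continuous G : C1 G -> continuous G.
Proof. by move=> [Gd _] x; exact: differentiable_continuous. Qed.

Lemma C1_diff_continuous G k : C1 G -> continuous (fun y => 'd G y k).
Proof.
move=> [_ Gc] x; apply/cvgrPdist_lt => e e0.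
have d0 : 0 < e / (`|k| + 1) by rewrite divr_gt0// ltr_wpDl.
apply: filterS (Gc x _ d0) => y /(_ k); rewrite distrC => h.
apply: le_lt_trans h _; rewrite mulrAC ltr_pdivrMr ?ltr_wpDl//.
by rewrite ltr_pM2l// ltrDl.
Qed.

(** [segment_growth] for [|'d G y k - 'd G x k|]: the rate is [C] from the second derivative plus
    [1] from the remainder taken with [e = 1]. *)
Lemma diff_lipschitz G x h (C : R) : C1 G ->
  (forall t, 0 <= t <= 1 -> is_diff2 G (x + t *: h) (diff2 G (x + t *: h)) /\
     bop_le (diff2 G (x + t *: h)) C) ->
  forall t k, 0 <= t <= 1 ->
    `|'d G (x + t *: h) k - 'd G x k| <= (C + 1) * (t * `|h|) * `|k|.
Proof.
move=> G1 GC t k t01.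
pose u y := `|'d G y k - 'd G x k|.
suff : u (x + t *: h) <= (C + 1) * `|k| * (t * `|h|) by rewrite /u; nra.
apply: segment_growth t01 => [y||s s01 _].
- apply: cvg_norm; apply: cvgB; last exact: cvg_cst.
  exact: C1_diff_continuous.
- by rewrite /u subrr normr0.
- have [[_ _ _ D2] D2C] := GC s s01.
  set y := x + s *: h in D2 D2C *.
  apply: filterS (D2 1 ltr01) => z /(_ k); rewrite mul1r => h1.
  have := D2C (z - y) k => h2.
  have -> : u z = `|('d G z k - 'd G y k - diff2 G y (z - y) k) +
     (diff2 G y (z - y) k + ('d G y k - 'd G x k))|.
    by rewrite /u addrA subrK addrA subrK.
  apply: le_trans (ler_normD _ _) _.
  apply: le_trans (lerD h1 (ler_normD _ _)) _.
  by rewrite /u; nra.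
Qed.

(** [G - 'd G x] has a Lipschitz constant of order [rho] on the ball: [L * rho] from the variation
    of the derivative, [rho] from the remainder. In [restoration] this makes the constraint map
    close to its linearisation. *)
Lemma diff_quadratic G x (L rho : R) : (forall y, differentiable G y) ->
  0 < rho ->
  (forall h k, `|h| <= rho -> `|'d G (x + h) k - 'd G x k| <= L * `|h| * `|k|) ->
  0 <= L ->
  forall h h', `|h| <= rho -> `|h'| <= rho ->
    `|G (x + h) - G (x + h') - 'd G x (h - h')| <= (L + 1) * rho * `|h - h'|.
Proof.
move=> Gd rho0 GL L0 h h' hr h'r.
pose u y := `|G y - G (x + h') - 'd G x (y - (x + h'))|.
have E : x + h' + 1 *: (h - h') = x + h.
  by rewrite scale1r -addrA [h' + _]addrC subrK.
have uE : u (x + h) = `|G (x + h) - G (x + h') - 'd G x (h - h')|.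
  by rewrite /u opprD [x + h + _]addrACA subrr add0r.
rewrite -uE -E -[`|h - h'|]mul1r.
apply: segment_growth => [y||s /andP[s0 s1] _|]; last by rewrite ler01 lexx.
- have Gc : {for y, continuous G} by exact: differentiable_continuous.
  apply: cvg_norm; apply: cvgB; first by apply: cvgB; [exact: Gc|exact: cvg_cst].
  have dc : continuous ('d G x) by have [] := (diff_locallyP x G).1 (Gd x).
  apply: (@continuous_comp _ _ _ (fun y => y - (x + h')) ('d G x)); last exact: dc.
  by apply: cvgB; [exact: cvg_id|exact: cvg_cst].
- by rewrite /u !subrr linear0 subrr normr0.
- set y := x + h' + s *: (h - h').
  (* The segment stays in the ball, [w] being a convex combination of [h'] and [h]. *)
  pose w := h' + s *: (h - h').
  have wr : `|w| <= rho.
    have -> : w = (1 - s) *: h' + s *: h.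
      by rewrite /w scalerBr scalerBl scale1r addrCA addrC.
    apply: le_trans (ler_normD _ _) _; rewrite !normrZ !ger0_norm ?subr_ge0//.
    nra.
  have yE : y = x + w by rewrite /y /w addrA.
  apply: filterS (diff_remainder (Gd y) rho0) => z h1.
  have := GL w (z - y) wr; rewrite -yE => h2.
  have -> : u z = `|(G z - G y - 'd G y (z - y)) +
     (('d G y (z - y) - 'd G x (z - y)) + (G y - G (x + h') - 'd G x (y - (x + h'))))|.
    have dE : 'd G x (z - (x + h')) = 'd G x (z - y) + 'd G x (y - (x + h')).
      by rewrite -linearD subrKA.
    rewrite /u dE -['d G y _ - _ + _]addrA subrKA -[G y - _ - _]addrA.
    by rewrite [- _ + (G y + _)]addrCA subrKA [- _ + (- _ + _)]addrCA -opprD addrA.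
  apply: le_trans (ler_normD _ _) _.
  apply: le_trans (lerD h1 (ler_normD _ _)) _.
  rewrite -/(u y); have := normr_ge0 (z - y).
  have : L * `|w| * `|z - y| <= L * rho * `|z - y|.
    by apply: ler_wpM2r => //; apply: ler_wpM2l.
  lra.
Qed.
End Differential.

(** * The product space of multipliers, its Hilbert norm, and fixed points in it *)

Section ProductForm.
Variables (R : realType) (H : hilbertType R) (m : nat).
Implicit Types u v : H * 'rV[R]_m.

Lemma vdot_formP : inner_form (@vdot R m).
Proof.
split=> [u v|u v w|a u v|u].
- by apply: eq_bigr => i _; rewrite mulrC.
- by rewrite -big_split; apply: eq_bigr => i _; rewrite mxE mulrDl.
- by rewrite /vdot mulr_sumr; apply: eq_bigr => i _; rewrite mxE mulrA.
- by apply: sumr_ge0 => i _; rewrite -expr2 sqr_ge0.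
Qed.

Lemma enorm_sqr (u : 'rV[R]_m) : enorm u ^+ 2 = vdot u u.
Proof. exact: (ipn_sqr vdot_formP). Qed.

Lemma le_enorm (u : 'rV[R]_m) i : `|u 0 i| <= enorm u.
Proof.
rewrite -sqrtr_sqr; apply: ler_wsqrtr; rewrite /vdot (bigD1 i)//= -expr2 lerDl.
by apply: sumr_ge0 => j _; rewrite -expr2 sqr_ge0.
Qed.

Lemma enorm_ge0 (u : 'rV[R]_m) : 0 <= enorm u.
Proof. exact: sqrtr_ge0. Qed.

Definition pdot (u v : H * 'rV[R]_m) : R := inner u.1 v.1 + vdot u.2 v.2.
Definition pnorm : H * 'rV[R]_m -> R := ipn pdot.

Lemma pdot_formP : inner_form pdot.
Proof.
split=> [u v|u v w|a u v|u]; rewrite /pdot /=.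
- by rewrite innerC (ipC vdot_formP).
- by rewrite innerDl (ipDl vdot_formP) addrACA.
- by rewrite innerZl (ipZl vdot_formP) mulrDr.
- by rewrite addr_ge0 ?(ip_ge0 vdot_formP)// inner_norm sqr_ge0.
Qed.

Lemma pnorm_sqr (u : H * 'rV[R]_m) : pnorm u ^+ 2 = `|u.1| ^+ 2 + enorm u.2 ^+ 2.
Proof. by rewrite (ipn_sqr pdot_formP) /pdot inner_norm enorm_sqr. Qed.

Lemma pnorm_ge0 u : 0 <= pnorm u. Proof. exact: ipn_ge0. Qed.

Lemma pnorm_fst u : `|u.1| <= pnorm u.
Proof.
rewrite -(@ler_pXn2r _ 2)// ?nnegrE ?pnorm_ge0//.
by rewrite pnorm_sqr lerDl sqr_ge0.
Qed.

Lemma pnorm_snd u : enorm u.2 <= pnorm u.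
Proof.
rewrite -(@ler_pXn2r _ 2)// ?nnegrE ?pnorm_ge0 ?enorm_ge0//.
by rewrite pnorm_sqr lerDr sqr_ge0.
Qed.

Lemma pnorm_coord u i : `|u.2 0 i| <= pnorm u.
Proof. exact: le_trans (le_enorm _ _) (pnorm_snd u). Qed.

Lemma enorm_le_sum (u : 'rV[R]_m) : enorm u <= \sum_i `|u 0 i|.
Proof.
have s0 : 0 <= \sum_i `|u 0 i| by exact: sumr_ge0.
rewrite -(@ler_pXn2r _ 2)// ?nnegrE ?enorm_ge0// enorm_sqr.
rewrite expr2 mulr_suml; apply: ler_sum => i _.
apply: le_trans (ler_norm _) _; rewrite normrM.
apply: ler_wpM2l => //; rewrite (bigD1 i)//= lerDl.
exact: sumr_ge0.
Qed.

Lemma pnorm_le_sum u : pnorm u <= `|u.1| + \sum_i `|u.2 0 i|.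
Proof.
apply: le_trans (lerD (lexx _) (enorm_le_sum u.2)).
rewrite -(@ler_pXn2r _ 2)// ?nnegrE ?pnorm_ge0 ?addr_ge0 ?enorm_ge0//.
rewrite pnorm_sqr; have := enorm_ge0 u.2; have := normr_ge0 u.1; nra.
Qed.

Lemma pnorm_le_coord u (a : R) :
  `|u.1| <= a -> (forall i, `|u.2 0 i| <= a) -> pnorm u <= (1 + m%:R) * a.
Proof.
move=> u1 u2; apply: le_trans (pnorm_le_sum u) _; rewrite mulrDl mul1r lerD//.
apply: le_trans (ler_sum _ (fun i _ => u2 i)) _.
by rewrite sumr_const card_ord mulr_natl.
Qed.

Lemma pnorm_eq0 u : pnorm u = 0 -> u = 0.
Proof.
move=> u0; rewrite [u]surjective_pairing; congr (_, _).
  by apply/eqP; rewrite -normr_le0 -u0 pnorm_fst.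
apply/rowP => i; rewrite mxE; apply/eqP.
by rewrite -normr_le0 -u0 pnorm_coord.
Qed.

(** The limit is taken coordinate by coordinate; [pnorm_le_sum] turns this into convergence in
    [pnorm]. *)
Lemma pnorm_complete (u : nat -> H * 'rV[R]_m) (A k : R) : 0 <= k < 1 ->
  (forall n, pnorm (u n.+1 - u n) <= A * k ^+ n) ->
  exists l, pnorm (u n - l) @[n --> \oo] --> (0 : R).
Proof.
move=> k01 uk.
have c1 : cvgn (fun n => (u n).1).
  apply: (geometric_cvg k01) => n; apply: le_trans (uk n).
  exact: pnorm_fst (u n.+1 - u n).
have c2 i : cvgn (fun n => (u n).2 0 i : R^o).
  apply: (@geometric_cvg R R^o _ A _ k01) => n; apply: le_trans (uk n).
  by have := pnorm_coord (u n.+1 - u n) i; rewrite !mxE.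
pose l := (limn (fun n => (u n).1), \row_i limn (fun n => (u n).2 0 i : R^o)).
exists l.
apply: (@squeeze_cvgr _ _ _ _ (cst 0)
  (fun n => `|(u n).1 - l.1| + \sum_i `|(u n).2 0 i - l.2 0 i|)).
- apply: nearW => n; rewrite pnorm_ge0/=.
  apply: le_trans (pnorm_le_sum _) _; rewrite lerD2l le_eqVlt; apply/orP; left.
  by apply/eqP; apply: eq_bigr => i _; rewrite !mxE.
- exact: cvg_cst.
- rewrite -[X in _ --> X](addr0 0); apply: cvgD.
    rewrite -(@normr0 _ H) -(subrr l.1); apply: cvg_norm.
    by apply: cvgB; [exact: c1|exact: cvg_cst].
  rewrite [X in _ --> X](_ : 0 = \sum_(i < m) 0); last by rewrite big1.
  apply: cvg_big => [|i _]; first exact: add_continuous.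
  rewrite -(@normr0 _ R) -(subrr (l.2 0 i)); apply: cvg_norm.
  apply: cvgB; last exact: cvg_cst.
  by rewrite mxE; exact: c2.
Qed.

(** Banach's theorem started at [0]: the bound on [T 0] keeps the iterates in the ball of radius
    [a], inside the ball of radius [rho] on which [T] contracts. *)
Lemma pnorm_fixed_point (T : H * 'rV[R]_m -> H * 'rV[R]_m) (k rho a : R) :
  0 <= k < 1 -> a <= rho ->
  (forall u v, pnorm u <= rho -> pnorm v <= rho ->
     pnorm (T u - T v) <= k * pnorm (u - v)) ->
  pnorm (T 0) <= (1 - k) * a ->
  exists2 u, pnorm u <= a & T u = u.
Proof.
move=> /andP[k0 k1] arho TL T0.
have a0 : 0 <= a.
  by rewrite -(@pmulr_rge0 _ (1 - k)) ?subr_gt0// (le_trans (pnorm_ge0 _) T0).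
pose u n := iter n T 0.
have pn0 : pnorm 0 = 0 by exact: (ipn0 pdot_formP).
have TD v : pnorm v <= rho -> pnorm (T v) <= k * pnorm v + (1 - k) * a.
  move=> vr; rewrite -[T v](subrK (T 0)).
  apply: le_trans (ipn_triangle pdot_formP _ _) _; apply: lerD => //.
  by have := TL v 0; rewrite subr0; apply => //; rewrite pn0 (le_trans a0).
have ua n : pnorm (u n) <= a.
  elim: n => [|n IH]; first by rewrite /= pn0.
  by apply: le_trans (TD _ (le_trans IH arho)) _; nra.
have uk n : pnorm (u n.+1 - u n) <= pnorm (T 0) * k ^+ n.
  elim: n => [|n IH]; first by rewrite /= subr0 mulr1.
  apply: le_trans (TL (u n.+1) (u n) _ _) _.
  - exact: le_trans (ua _) arho.
  - exact: le_trans (ua _) arho.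
  - by rewrite exprS mulrCA; apply: ler_wpM2l.
have [l ul] : exists l, pnorm (u n - l) @[n --> \oo] --> (0 : R).
  by apply: pnorm_complete uk; rewrite k0.
have la : pnorm l <= a.
  have ul' : a + pnorm (u n - l) @[n --> \oo] --> a.
    by rewrite -[X in _ --> X]addr0; apply: cvgD => //; exact: cvg_cst.
  apply: (ler_cvg_to (cvg_cst (pnorm l)) ul'); apply: nearW => n.
  rewrite -{1}(subrK (u n) l); apply: le_trans (ipn_triangle pdot_formP _ _) _.
  by rewrite addrC lerD// (ipn_distC pdot_formP).
exists l => //.
suff : pnorm (T l - l) <= 0.
  move=> h; apply/eqP; rewrite -subr_eq0; apply/eqP/pnorm_eq0/le_anti.
  by rewrite h pnorm_ge0.
have ul1 : pnorm (u n.+1 - l) @[n --> \oo] --> (0 : R).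
  by rewrite (cvg_shiftS (fun n => pnorm (u n - l))).
have ul2 : k * pnorm (u n - l) + pnorm (u n.+1 - l) @[n --> \oo] --> (0 : R).
  by rewrite -[X in _ --> X]addr0 -[X in _ --> X + _](mulr0 k);
    apply: cvgD => //; apply: cvgMr.
apply: (ler_cvg_to (cvg_cst (pnorm (T l - l))) ul2); apply: nearW => n.
rewrite -[T l - l](subrKA (u n.+1)); apply: le_trans (ipn_triangle pdot_formP _ _) _.
apply: lerD => //.
have -> : pnorm (u n - l) = pnorm (l - u n) by exact: (ipn_distC pdot_formP).
by apply: TL; [exact: le_trans la _|exact: le_trans (ua n) _].
Qed.
End ProductForm.

(** * Gradients, adjoints, and the operators built from the constraints *)

Lemma grad_inner (R : realType) (X : hilbertType R) (G : X -> R) (x h : X) :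
  differentiable G x -> 'd G x h = inner (grad G x) h.
Proof.
move=> Gx; have [C _ GC] := diff_op_le Gx.
(* Riesz gives a representing vector, so the [get] in [grad] returns one and not its default
   value. *)
have [v vP] : exists v, forall h, 'd G x h = inner v h.
  apply: (riesz (C := C)) => [y z|a y|y]; first exact: linearD.
  - exact: linearZ.
  - exact: GC.
rewrite /grad; case: xgetP => [w _ -> //|/(_ v)]; by case.
Qed.

Lemma adjoint_inner (R : realType) (X H : hilbertType R) (G : X -> H) (x h : X)
    (y : H) :
  differentiable G x -> inner ('d G x h) y = inner h (adjoint ('d G x) y).
Proof.
move=> Gx; have [C _ GC] := diff_op_le Gx.
have [v vP] : exists v, forall h, inner ('d G x h) y = inner v h.
  apply: (riesz (C := `|y| * C)) => [z w|a z|z].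
  - by rewrite linearD innerDl.
  - by rewrite linearZ innerZl.
  - apply: le_trans (inner_CS _ _) _; rewrite mulrC -mulrA.
    by apply: ler_wpM2l => //; exact: GC.
rewrite /adjoint; case: xgetP => [w _ -> //|/(_ v)].
by case => z; rewrite vP innerC.
Qed.

Lemma is_diff_inner (R : realType) (H : hilbertType R) (lam x : H) :
  is_diff x (inner lam) (inner lam).
Proof.
pose l : {linear H -> R^o} := HB.pack (inner lam : H -> R^o)
  (GRing.isLinear.Build R H R^o *:%R (inner lam) (fun a u v =>
     etrans (ipDr (inner_formP H) _ _ _)
       (congr1 (+%R^~ _) (ipZr (inner_formP H) _ _ _)))).
have lc : continuous l.
  apply/linear_bounded_continuous/linear_boundedP.
  exists `|lam|; split => // C lC y; apply: le_trans (inner_CS _ _) _.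
  by apply: ler_wpM2r => //; exact: ltW.
apply: DiffDef; first exact: (@linear_differentiable _ _ _ l _ lc).
exact: (@diff_lin _ _ _ l _ lc).
Qed.

Section Operators.
Variables (R : realType) (X H : hilbertType R) (m : nat).
Variables (f : X -> R) (F : X -> H) (g : 'I_m -> X -> R).
Hypothesis fd : forall x, differentiable f x.
Hypothesis Fd : forall x, differentiable F x.
Hypothesis gd : forall i x, differentiable (g i) x.
Local Notation V := (H * 'rV[R]_m)%type.
Implicit Types (x h : X) (xi zeta : V).

(* [jac] is the derivative of the constraint map [(F, g)], [jacT] its adjoint,
   and [slack] the diagonal part [diag(g_i(x)^2)] occurring in [Q] and [eta]. *)
Definition jac x h : V := ('d F x h, gradg g x h).

Definition jacT x xi : X :=
  adjoint ('d F x) xi.1 + \sum_i xi.2 0 i *: grad (g i) x.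

Definition slack x xi : V := (0, xi.2 *m diag_mx (\row_i g i x ^+ 2)).

(** The operator [B] of the overview, [jac] and [jacT] being [A] and its adjoint. *)
Definition qop x xi : V := jac x (jacT x xi) + slack x xi.

Lemma slackE x xi i : (slack x xi).2 0 i = xi.2 0 i * g i x ^+ 2.
Proof. by rewrite /slack /= mul_mx_diag !mxE. Qed.

Lemma jacE x h i : (jac x h).2 0 i = 'd (g i) x h.
Proof. by rewrite /jac /= mxE grad_inner. Qed.

Lemma jacT_inner x xi h : inner (jacT x xi) h = pdot xi (jac x h).
Proof.
have ipX := inner_formP X.
rewrite /pdot /jac /= (innerC xi.1) adjoint_inner// (innerC h) innerDl; congr +%R.
rewrite /vdot; elim/big_ind2 : _ => [|u a v b ua vb|i _].
- exact: (ip0l ipX).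
- by rewrite innerDl ua vb.
- by rewrite innerZl mxE.
Qed.

Lemma jacD x h k : jac x (h + k) = jac x h + jac x k.
Proof.
rewrite /jac linearD; congr (_, _); apply/rowP => i; rewrite !mxE.
by rewrite (ipDr (inner_formP X)).
Qed.

Lemma jacN x h : jac x (- h) = - jac x h.
Proof.
rewrite /jac linearN; congr (_, _); apply/rowP => i; rewrite !mxE.
by rewrite (ipNr (inner_formP X)).
Qed.

(** The adjoint is obtained by choice, so linearity is read off from the pairing with every [h]. *)
Lemma jacT_B x xi zeta : jacT x (xi - zeta) = jacT x xi - jacT x zeta.
Proof.
apply: inner_inj => h.
by rewrite (ipBl (inner_formP X)) !jacT_inner (ipBl (pdot_formP H m)).
Qed.

Lemma qop_B x xi zeta : qop x (xi - zeta) = qop x xi - qop x zeta.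
Proof.
rewrite /qop jacT_B jacD jacN opprD addrACA; congr (_ + _).
rewrite /slack; congr (_, _); first by rewrite /= subr0.
by rewrite /= mulmxBl.
Qed.

Lemma qop_Z x a xi : qop x (a *: xi) = a *: qop x xi.
Proof.
have jT : jacT x (a *: xi) = a *: jacT x xi.
  apply: inner_inj => h.
  by rewrite innerZl !jacT_inner (ipZl (pdot_formP H m)).
rewrite /qop jT [RHS]scalerDr; congr (_ + _).
  rewrite /jac linearZ; congr (_, _); apply/rowP => i; rewrite !mxE.
  by rewrite (ipZr (inner_formP X)).
rewrite /slack; congr (_, _); first by rewrite /= scaler0.
by rewrite /= -scalemxAl.
Qed.

Lemma qop_sym x xi zeta : pdot (qop x xi) zeta = pdot xi (qop x zeta).
Proof.
have ipV := pdot_formP H m.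
rewrite (ipDl ipV) (ipDr ipV) (ipC ipV (jac x _)) -!jacT_inner innerC.
congr (_ + _); rewrite /pdot /slack /= (ip0l (inner_formP H)).
rewrite (innerC _ 0) (ip0l (inner_formP H)) !add0r /vdot.
by apply: eq_bigr => i _; rewrite !mul_mx_diag !mxE mulrAC mulrA.
Qed.

Lemma Q_qop x xi : Q F g x xi.1 xi.2 = 2^-1 * pnorm (qop x xi) ^+ 2.
Proof.
by rewrite /Q -/(jacT x xi) -mulrDr pnorm_sqr /= addr0.
Qed.

Lemma is_diff_Lag x (lam : H) (mu : 'rV[R]_m) :
  is_diff x (fun y => Lag f F g y lam mu) (fun h =>
    'd f x h + inner lam ('d F x h) + \sum_i mu 0 i * 'd (g i) x h).
Proof.
have dF : is_diff x (inner lam \o F) (inner lam \o 'd F x).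
  apply: is_diff_comp; first exact: differentiableP.
  exact: is_diff_inner.
have dg : is_diff x (\sum_i mu 0 i *: g i) (\sum_i mu 0 i *: ('d (g i) x : X -> R)).
  elim/big_ind2 : _ => [|u a v b ua vb|i _].
  - exact: is_diff_cst.
  - exact: is_diffD.
  - by apply: is_diffZ; exact: differentiableP.
have -> : (fun y => Lag f F g y lam mu) = f + (inner lam \o F) + \sum_i mu 0 i *: g i.
  by apply/funext => y; rewrite /Lag !fctE fct_sumE.
apply: is_diff_eq.
  exact: (is_diffD (is_diffD (differentiableP (fd x)) dF) dg).
by apply/funext => h; rewrite !fctE fct_sumE.
Qed.

Lemma gradL_jacT x lam mu : gradL f F g x lam mu = grad f x + jacT x (lam, mu).
Proof.
have dL := is_diff_Lag x lam mu.
apply: inner_inj => h; rewrite -grad_inner; last exact: ex_diff.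
rewrite diff_val innerDl -grad_inner// jacT_inner -addrA; congr (_ + (_ + _)).
by apply: eq_bigr => i _; rewrite -jacE.
Qed.

(** Half the squared norm of this vector is [eta]. By [gradL_jacT] it is affine in the multipliers,
    with linear part [qop x]. *)
Definition etaop x lam mu : V :=
  jac x (gradL f F g x lam mu) + slack x (lam, mu).

Lemma eta_etaop x lam mu : Defs.eta f F g x lam mu = 2^-1 * pnorm (etaop x lam mu) ^+ 2.
Proof.
rewrite pnorm_sqr /= addr0 mulrDr enorm_sqr; congr (_ + _ * _).
by apply: eq_bigr => i _; rewrite mul_mx_diag !mxE expr2 [mu 0 i * _]mulrC.
Qed.
End Operators.

(** * Solving a nearly linear equation *)

Section Picard.
Variables (R : realType) (H : hilbertType R) (m : nat).
Local Notation V := (H * 'rV[R]_m)%type.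
Let ipV := pdot_formP H m.

(* Damped normal-equation iteration [u - b^-2 B (Phi u)]: since [B] is
   symmetric, [|w - b^-2 B B w|^2 <= (1 - beta^2 / b^2) |w|^2], so that no
   inverse of [B] is needed. *)
Lemma picard_zero (B Phi : V -> V) (beta b rho : R) :
  (forall u v, B (u - v) = B u - B v) ->
  (forall u v, pdot (B u) v = pdot u (B v)) ->
  (forall u, beta * pnorm u <= pnorm (B u)) ->
  (forall u, pnorm (B u) <= b * pnorm u) ->
  0 < beta <= b ->
  (forall u v, pnorm u <= rho -> pnorm v <= rho ->
    pnorm (Phi u - Phi v - B (u - v)) <= beta ^+ 2 / (4 * b) * pnorm (u - v)) ->
  4 * b / beta ^+ 2 * pnorm (Phi 0) <= rho ->
  exists2 u, pnorm u <= 4 * b / beta ^+ 2 * pnorm (Phi 0) & Phi u = 0.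
Proof.
move=> BB Bsym Blb Bub /andP[beta0 betab] PhiL Phi0.
have b0 : 0 < b by exact: lt_le_trans betab.
pose tau := b ^- 2.
have tau0 : 0 < tau by rewrite invr_gt0 exprn_gt0.
have taub : tau * b ^+ 2 = 1 by rewrite mulVf// expf_neq0// gt_eqF.
pose t := tau * beta ^+ 2.
have t0 : 0 < t by rewrite mulr_gt0// exprn_gt0.
have t1 : t <= 1.
  rewrite -taub /t; apply: ler_wpM2l; first exact: ltW.
  by rewrite ler_pXn2r// nnegrE ltW.
have tau_lin : tau * (b * (beta ^+ 2 / (4 * b))) = t / 4.
  by rewrite /t; field; rewrite gt_eqF.
(* The expansion gives [|w|^2 - 2 tau |B w|^2 + tau^2 |B B w|^2], at most [(1 - t) |w|^2], and
   [1 - t <= (1 - t / 2)^2]. *)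
have contr w : pnorm (w - tau *: B (B w)) <= (1 - t / 2) * pnorm w.
  rewrite -(@ler_pXn2r _ 2)// ?nnegrE ?mulr_ge0 ?pnorm_ge0//; last by lra.
  rewrite exprMn (ipn_sqr ipV) (ipBl ipV) !(ipBr ipV) !(ipZl ipV) !(ipZr ipV).
  rewrite (Bsym (B w) w) -!(Bsym w) -!(ipn_sqr ipV) -!/(pnorm _).
  have h1 : pnorm (B (B w)) ^+ 2 <= b ^+ 2 * pnorm (B w) ^+ 2.
    by rewrite -exprMn ler_pXn2r// ?nnegrE ?mulr_ge0 ?pnorm_ge0// ltW.
  have h2 : beta ^+ 2 * pnorm w ^+ 2 <= pnorm (B w) ^+ 2.
    by rewrite -exprMn ler_pXn2r// ?nnegrE ?mulr_ge0 ?pnorm_ge0// ltW.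
  have h3 : tau * (tau * pnorm (B (B w)) ^+ 2) <= tau * pnorm (B w) ^+ 2.
    apply: ler_wpM2l; first exact: ltW.
    apply: le_trans (ler_wpM2l (ltW tau0) h1) _.
    by rewrite mulrA taub mul1r.
  have h4 : t * pnorm w ^+ 2 <= tau * pnorm (B w) ^+ 2.
    by rewrite /t -mulrA; apply: ler_wpM2l => //; exact: ltW.
  have := sqr_ge0 (t * pnorm w); lra.
pose T u := u - tau *: B (Phi u).
have [u ua Tu] : exists2 u, pnorm u <= 4 * b / beta ^+ 2 * pnorm (Phi 0) & T u = u.
  (* The deviation of [Phi] from [B] costs [t / 4] by [tau_lin], which leaves the contraction factor
     [1 - t / 4]. The radius is such that [t / 4] times it equals [tau * b * pnorm (Phi 0)], a bound
     for [T 0]. *)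
  apply: (@pnorm_fixed_point _ _ _ T (1 - t / 4) rho) => //.
  - by apply/andP; split; lra.
  - move=> u v ur vr; set w := u - v.
    have -> : T u - T v = (w - tau *: B (B w)) - tau *: B (Phi u - Phi v - B w).
      have -> : B (Phi u - Phi v - B w) = B (Phi u) - B (Phi v) - B (B w).
        by rewrite 2!BB.
      rewrite !scalerBr /T /w; move: (tau *: B (Phi u)) (tau *: B (Phi v)) => p q.
      by rewrite [- (_ - _ - tau *: _)]opprB subrKA !opprD addrACA.
    apply: le_trans (ipn_triangleB ipV _ _) _.
    rewrite (ipnZ ipV) (gtr0_norm tau0) -!/(pnorm _).
    have h1 : tau * pnorm (B (Phi u - Phi v - B w)) <= t / 4 * pnorm w.
      rewrite -tau_lin -mulrA; apply: ler_wpM2l; first exact: ltW.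
      apply: le_trans (Bub _) _; rewrite -mulrA; apply: ler_wpM2l; first exact: ltW.
      exact: PhiL.
    have := contr w; lra.
  - have -> : T 0 = - (tau *: B (Phi 0)) by rewrite /T sub0r.
    have -> : pnorm (- (tau *: B (Phi 0))) = tau * pnorm (B (Phi 0)).
      by rewrite /pnorm (ipnN ipV) (ipnZ ipV) gtr0_norm.
    apply: le_trans (ler_wpM2l (ltW tau0) (Bub _)) _.
    rewrite le_eqVlt; apply/orP; left; apply/eqP; rewrite /t; field.
    by rewrite gt_eqF.
exists u => //.
(* A fixed point only gives [B (Phi u) = 0]; the lower bound [Blb] removes [B]. *)
have BPhi : B (Phi u) = 0.
  move: Tu => /eqP; rewrite /T -subr_eq0 addrAC subrr add0r oppr_eq0.
  by rewrite scaler_eq0 gt_eqF//= => /eqP.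
apply: pnorm_eq0; apply/le_anti; rewrite pnorm_ge0 andbT.
have := Blb (Phi u); rewrite BPhi [X in _ <= X](ipn0 ipV).
by rewrite pmulr_rle0.
Qed.
End Picard.

(** * Operator bounds and the truncated slack *)

Section Bounds.
Variables (R : realType) (X H : hilbertType R) (m : nat).
Variables (f : X -> R) (F : X -> H) (g : 'I_m -> X -> R).
Hypothesis fd : forall x, differentiable f x.
Hypothesis Fd : forall x, differentiable F x.
Hypothesis gd : forall i x, differentiable (g i) x.
Local Notation V := (H * 'rV[R]_m)%type.
Let ipV := pdot_formP H m.

Lemma grad_le x C : 0 <= C -> op_le ('d f x) C -> `|grad f x| <= C.
Proof.
move=> C0 fC; have := fC (grad f x); rewrite grad_inner// inner_norm.
rewrite normrX normr_id.
have [->//|n0] := eqVneq `|grad f x| 0.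
by rewrite expr2 ler_pM2r ?lt_def ?n0 ?normr_ge0.
Qed.

Variables (x : X) (C : R).
Hypothesis C0 : 0 <= C.
Hypothesis FC : op_le ('d F x) C.
Hypothesis gC : forall i, op_le ('d (g i) x) C /\ `|g i x| <= C.
Let K : R := (1 + m%:R) * C.
Let K0 : 0 <= K. Proof. by rewrite mulr_ge0// addr_ge0. Qed.

Lemma jac_le h : pnorm (jac F g x h) <= (1 + m%:R) * C * `|h|.
Proof.
rewrite -mulrA; apply: pnorm_le_coord => [|i]; first exact: FC.
by rewrite jacE//; have [+ _] := gC i; exact.
Qed.

(** Duality: the image is paired with itself and the bound on [jac] is transferred. *)
Lemma jacT_le (xi : V) : `|jacT F g x xi| <= (1 + m%:R) * C * pnorm xi.
Proof.
set h := jacT F g x xi.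
have [->|h0] := eqVneq `|h| 0; first by rewrite mulr_ge0// pnorm_ge0.
have hp : 0 < `|h| by rewrite lt_def h0/=.
rewrite -(ler_pM2r hp) -expr2 -inner_norm {1}/h jacT_inner//.
apply: le_trans (ip_le ipV _ _) _; rewrite mulrAC mulrC.
by apply: ler_wpM2r (jac_le h); exact: pnorm_ge0.
Qed.

Lemma slack_le (xi : V) : pnorm (slack g x xi) <= (1 + m%:R) * C ^+ 2 * pnorm xi.
Proof.
rewrite -mulrA; apply: pnorm_le_coord => [|i].
  by rewrite /= normr0 mulr_ge0 ?sqr_ge0 ?pnorm_ge0.
rewrite slackE normrM mulrC normrX; apply: ler_pM => //; last exact: pnorm_coord.
by rewrite ler_pXn2r//; have [] := gC i.
Qed.

Definition qop_bound (m : nat) (C : R) : R :=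
  ((1 + m%:R) * C) ^+ 2 + (1 + m%:R) * C ^+ 2.

Lemma qop_le (xi : V) : pnorm (qop F g x xi) <= qop_bound m C * pnorm xi.
Proof.
rewrite mulrDl; apply: le_trans (ipn_triangle ipV _ _) _.
apply: lerD (slack_le xi); apply: le_trans (jac_le _) _.
by rewrite -/K expr2 -mulrA; apply: ler_wpM2l => //; exact: jacT_le.
Qed.

End Bounds.

(** Here [y] stands for [g_i(x)] and [s] for its slack. If [s >= |y| / 2], neither maximum
    truncates, since [y^2 |c| <= |y| / 2] for [|c| <= rho], and the difference is zero. Otherwise
    [|y| <= 2 delta], and since the positive part is monotone and 1-Lipschitz the error is at most
    [y^2 |a - b|]. *)
Lemma relu_linear (R : realType) (s y C a b delta rho : R) :
  0 <= s -> `|y| <= C -> `|y + s| <= delta -> C * rho <= 2^-1 ->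
  `|a| <= rho -> `|b| <= rho ->
  `|Num.max (s + y ^+ 2 * a) 0 - Num.max (s + y ^+ 2 * b) 0 - y ^+ 2 * (a - b)|
    <= 4 * delta ^+ 2 * `|a - b|.
Proof.
move=> s0 yC ysd Crho ar br.
have d0 : 0 <= delta := le_trans (normr_ge0 _) ysd.
have [ys|sy] := leP (`|y| / 2) s.
  have pos c : `|c| <= rho -> 0 <= s + y ^+ 2 * c.
    move=> cr; suff : `|y ^+ 2 * c| <= s by rewrite ler_norml; lra.
    rewrite normrM normrX expr2; have rho0 := le_trans (normr_ge0 _) cr.
    have : `|y| * `|c| <= 2^-1.
      by apply: le_trans Crho; apply: ler_pM.
    by have := normr_ge0 y; nra.
  rewrite !max_l ?pos//.
  have -> : s + y ^+ 2 * a - (s + y ^+ 2 * b) - y ^+ 2 * (a - b) = 0 by ring.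
  by rewrite normr0 !mulr_ge0// sqr_ge0.
have yd : y ^+ 2 <= 4 * delta ^+ 2.
  have : `|y| <= 2 * delta.
    have := lerB_normD y s; rewrite (ger0_norm s0); lra.
  move=> h; rewrite -[y ^+ 2]ger0_norm ?sqr_ge0// normrX.
  by have := normr_ge0 y; nra.
apply: le_trans (ler_wpM2r (normr_ge0 _) yd).
have -> : y ^+ 2 * `|a - b| = `|y ^+ 2 * (a - b)|.
  by rewrite normrM (ger0_norm (sqr_ge0 y)).
set w := y ^+ 2 * (a - b).
have -> : s + y ^+ 2 * a = s + y ^+ 2 * b + w by rewrite /w; ring.
have w1 := ler_norm w; have w2 := ler_norm (- w); rewrite normrN in w2.
rewrite ler_norml !maxEle; do 2![case: ifPn; rewrite -?ltNge => ?].
all: by apply/andP; split; lra.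
Qed.

Lemma near_small (R : realType) (A t : R) : 0 < t ->
  \forall d \near 0^'+, A * d <= t.
Proof.
move=> t0; have e0 : 0 < t / (`|A| + 1) by rewrite divr_gt0// ltr_wpDl.
near=> d.
have d0 : 0 < d by near: d; exact: nbhs_right_gt.
have : d <= t / (`|A| + 1) by near: d; exact: nbhs_right_le.
rewrite ler_pdivlMr ?ltr_wpDl// mulrC => dt; apply: le_trans dt.
by rewrite ler_pM2r//; have := ler_norm A; lra.
Unshelve. all: by end_near. Qed.

(** * Restoration of feasibility *)

Section Restoration.
Variables (R : realType) (X H : hilbertType R) (m : nat).
Variables (f : X -> R) (F : X -> H) (g : 'I_m -> X -> R).
Hypothesis fd : forall x, differentiable f x.
Hypothesis Fd : forall x, differentiable F x.
Hypothesis gd : forall i x, differentiable (g i) x.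
Local Notation V := (H * 'rV[R]_m)%type.
Let ipV := pdot_formP H m.

(** The derivative is compared with its value at the centre [x], the form in which [diff_quadratic]
    uses it. *)
Definition lipd (Y : normedModType R) (G : X -> Y) (x : X) (C L rho : R) :=
  op_le ('d G x) C /\
  forall h k, `|h| <= rho -> `|'d G (x + h) k - 'd G x k| <= L * `|h| * `|k|.

Definition regular (x : X) (C L rho : R) :=
  [/\ lipd f x C L rho, lipd F x C L rho &
      forall i, lipd (g i) x C L rho /\ `|g i x| <= C].

(** [picard_zero] is applied to the map [Phi] below, whose linearisation at [0] is [qop]; a zero of
    [Phi] is a feasible point because the truncated slack is nonnegative. The constants [d] and [K]
    are chosen before [x], hence uniform. *)
Lemma restoration (C L rho beta : R) : 0 < C -> 0 <= L -> 0 < rho -> 0 < beta ->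
  exists d K : R, [/\ 0 < d <= 1, 0 < K, (1 + m%:R) * C * (K * d) <= rho,
   C * (K * d) <= 2^-1 &
   forall x, regular x C L rho ->
     (forall xi, beta * pnorm xi <= pnorm (qop F g x xi)) ->
   forall s : 'rV[R]_m, (forall i, 0 <= s 0 i) ->
     pnorm (F x, \row_i (g i x + s 0 i)) <= d ->
   exists xi : V, [/\ pnorm xi <= K * pnorm (F x, \row_i (g i x + s 0 i)),
     F (x + jacT F g x xi) = 0 &
     forall i, g i (x + jacT F g x xi) =
       - Num.max (s 0 i + g i x ^+ 2 * xi.2 0 i) 0]].
Proof.
move=> C0 L0 rho0 beta0.
(* The maximum with [beta] secures [beta <= b], as [picard_zero] requires. *)
pose b := Num.max (qop_bound m C) beta.
have betab : 0 < beta <= b by rewrite beta0 le_max lexx orbT.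
have b0 : 0 < b by exact: lt_le_trans (andP betab).2.
pose K := 4 * b / beta ^+ 2.
have K0 : 0 < K by rewrite divr_gt0 ?exprn_gt0 ?mulr_gt0.
pose K1 := (1 + m%:R) * C.
have m1 : 0 < 1 + m%:R :> R by rewrite ltr_pwDl.
have K10 : 0 < K1 by rewrite mulr_gt0.
have th0 : 0 < beta ^+ 2 / (4 * b) by rewrite divr_gt0 ?exprn_gt0 ?mulr_gt0.
near (0 : R)^'+ => d.
have d0 : 0 < d by near: d; exact: nbhs_right_gt.
have d1 : d <= 1 by near: d; exact: nbhs_right_le.
have c1 : K1 * (K * d) <= rho by rewrite mulrA; near: d; exact: near_small.
have c2 : C * (K * d) <= 2^-1 by rewrite mulrA; near: d; exact: near_small.
(* The tolerance of [picard_zero]: the first summand is the Taylor error, [4] comes from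
   [relu_linear], and [1 + m] from summing the coordinates. *)
have c3 : (1 + m%:R) * ((L + 1) * (K1 * K) * K1 + 4) * d <= beta ^+ 2 / (4 * b).
  by near: d; exact: near_small.
exists d, K; split => //; first by rewrite d0.
move=> x [_ [FC FL] gCL] qb s s0 dl.
have gC i : op_le ('d (g i) x) C /\ `|g i x| <= C by have [[]] := gCL i.
pose J := jacT F g x.
pose Phi (xi : V) : V := (F (x + J xi),
  \row_i (g i (x + J xi) + Num.max (s 0 i + g i x ^+ 2 * xi.2 0 i) 0)).
have J_le xi : `|J xi| <= K1 * pnorm xi by apply: jacT_le => //; exact: ltW.
have J0 : J 0 = 0.
  apply/eqP; rewrite -normr_le0; apply: le_trans (J_le 0) _.
  by rewrite [pnorm 0](ipn0 ipV) mulr0.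
have Phi0 : Phi 0 = (F x, \row_i (g i x + s 0 i)).
  rewrite /Phi J0 addr0; congr (_, _); apply/rowP => i.
  by rewrite !mxE mulr0 addr0 max_l.
pose r := K1 * (K * d).
have r0 : 0 < r by apply: mulr_gt0 => //; exact: mulr_gt0.
have PhiL (u v : V) : pnorm u <= K * d -> pnorm v <= K * d ->
    pnorm (Phi u - Phi v - qop F g x (u - v))
    <= beta ^+ 2 / (4 * b) * pnorm (u - v).
  move=> ud vd.
  have Ju : `|J u| <= r by apply: le_trans (J_le u) _; rewrite ler_pM2l.
  have Jv : `|J v| <= r by apply: le_trans (J_le v) _; rewrite ler_pM2l.
  have JB : `|J u - J v| <= K1 * pnorm (u - v) by rewrite /J -jacT_B.
  (* The quadratic estimate is used with radius [r], proportional to [d], rather than [rho]; this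
     gives the small factor [d]. *)
  have quad (Y : normedModType R) (G : X -> Y) : (forall y, differentiable G y) ->
      (forall h k, `|h| <= rho -> `|'d G (x + h) k - 'd G x k| <= L * `|h| * `|k|) ->
      `|G (x + J u) - G (x + J v) - 'd G x (J u - J v)|
        <= (L + 1) * (K1 * K) * K1 * d * pnorm (u - v).
    move=> Gd GL; apply: le_trans (diff_quadratic Gd r0 _ L0 Ju Jv) _.
      by move=> h k hr; apply: GL; exact: le_trans c1.
    have -> : (L + 1) * (K1 * K) * K1 * d * pnorm (u - v) =
      (L + 1) * r * (K1 * pnorm (u - v)) by rewrite /r; ring.
    by apply: ler_wpM2l => //; rewrite mulr_ge0 ?addr_ge0// ltW.
  have w0 : 0 <= pnorm (u - v) by exact: pnorm_ge0.
  have d2 : 4 * d ^+ 2 * pnorm (u - v) <= 4 * d * pnorm (u - v).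
    by apply: ler_wpM2r => //; nra.
  apply: (@le_trans _ _ ((1 + m%:R) *
      (((L + 1) * (K1 * K) * K1 + 4) * d * pnorm (u - v)))); last first.
    by rewrite [leLHS]mulrA [X in X * _ <= _]mulrA; apply: ler_wpM2r.
  have -> : ((L + 1) * (K1 * K) * K1 + 4) * d * pnorm (u - v) =
    (L + 1) * (K1 * K) * K1 * d * pnorm (u - v) + 4 * d * pnorm (u - v) by ring.
  have uvB : qop F g x (u - v) = jac F g x (J u - J v) + slack g x (u - v).
    by rewrite /qop jacT_B.
  apply: pnorm_le_coord => [|i].
    rewrite uvB /= addr0; apply: le_trans (quad _ _ Fd FL) _.
    by rewrite lerDl !mulr_ge0// ltW.
  have [[_ gL] _] := gCL i.
  have cB (a c : V) : (a - c).2 0 i = a.2 0 i - c.2 0 i by rewrite !mxE.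
  have cD (a c : V) : (a + c).2 0 i = a.2 0 i + c.2 0 i by rewrite !mxE.
  rewrite 2!cB uvB cD jacE// slackE cB /Phi /= !mxE.
  set p := Num.max _ _; set q := Num.max _ _.
  set D := 'd (g i) x (J u - J v).
  have -> : g i (x + J u) + p - (g i (x + J v) + q) - (D + (u.2 0 i - v.2 0 i) * g i x ^+ 2)
    = (g i (x + J u) - g i (x + J v) - D) + (p - q - g i x ^+ 2 * (u.2 0 i - v.2 0 i)) by ring.
  apply: le_trans (ler_normD _ _) _; apply: lerD; first exact: quad.
  apply: le_trans d2.
  have uvi : `|u.2 0 i - v.2 0 i| <= pnorm (u - v).
    by have := pnorm_coord (u - v) i; rewrite !mxE.
  apply: le_trans (relu_linear (s0 i) (gC i).2 _ c2 _ _) _.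
  - by apply: le_trans dl; have := pnorm_coord (F x, \row_i (g i x + s 0 i)) i; rewrite mxE; exact.
  - exact: le_trans (pnorm_coord u i) ud.
  - exact: le_trans (pnorm_coord v i) vd.
  - by apply: ler_wpM2l => //; rewrite mulr_ge0// sqr_ge0.
have qub u : pnorm (qop F g x u) <= b * pnorm u.
  apply: le_trans (qop_le Fd gd (ltW C0) FC gC u) _.
  by apply: ler_wpM2r; [exact: pnorm_ge0|rewrite le_max lexx].
have Phi0d : 4 * b / beta ^+ 2 * pnorm (Phi 0) <= K * d.
  by rewrite Phi0 ler_pM2l.
have [xi xiK Phixi] :=
  picard_zero (qop_B g Fd x) (qop_sym g Fd x) qb qub betab PhiL Phi0d.
exists xi; split.
- by rewrite -Phi0.
- exact: (congr1 fst Phixi).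
- move=> i; have := congr1 (fun w : V => w.2 0 i) Phixi.
  by rewrite /Phi /= !mxE => /eqP; rewrite addr_eq0 => /eqP.
Unshelve. all: by end_near. Qed.
End Restoration.

(** * Comparison with the restored feasible point *)

Lemma lipd_taylor (R : realType) (X : hilbertType R) (Y : normedModType R) (G : X -> Y) (x h : X)
    (C L rho : R) : (forall y, differentiable G y) -> 0 <= L ->
  lipd G x C L rho -> `|h| <= rho ->
  `|G (x + h) - G x - 'd G x h| <= (L + 1) * `|h| ^+ 2.
Proof.
move=> Gd L0 [_ GL] hr; have [h0|h0] := eqVneq h 0.
  by rewrite h0 addr0 subrr linear0 subrr normr0 mulr_ge0 ?addr_ge0 ?sqr_ge0.
have hp : 0 < `|h| by rewrite normr_gt0.
have := @diff_quadratic R X Y G x L `|h| Gd hp _ L0 h 0 (lexx _).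
rewrite addr0 subr0 normr0 expr2 mulrA; apply; last exact: normr_ge0.
by move=> k l kh; apply: GL; exact: le_trans hr.
Qed.

Section Comparison.
Variables (R : realType) (X H : hilbertType R) (m : nat).
Variables (f : X -> R) (F : X -> H) (g : 'I_m -> X -> R).
Hypothesis fd : forall x, differentiable f x.
Hypothesis Fd : forall x, differentiable F x.
Hypothesis gd : forall i x, differentiable (g i) x.
Local Notation V := (H * 'rV[R]_m)%type.
Let ipV := pdot_formP H m.

(* The slack correction [g_i(x)^2 nu_i] of the restored point cancels the term
   [g_i(x)^2 mu_i] by which [eta] differs from the derivative of [L]. *)
Lemma etaop_pairing x (lam : H) (mu : 'rV[R]_m) (xi : V) :
  let h := jacT F g x xi in
  'd f x h + inner lam ('d F x h)
    + \sum_i mu 0 i * ('d (g i) x h + g i x ^+ 2 * xi.2 0 i)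
  = pdot xi (etaop f F g x lam mu).
Proof.
move=> h; rewrite /etaop (ipDr ipV) -jacT_inner// [in RHS]innerC gradL_jacT// innerDl.
rewrite -grad_inner// jacT_inner// /pdot /slack /= (innerC _ 0).
rewrite (ip0l (inner_formP H)) add0r -/h -!addrA; congr (_ + (_ + _)).
rewrite /vdot -big_split; apply: eq_bigr => i _ /=.
by rewrite mul_mx_diag !mxE grad_inner//; ring.
Qed.

(** Taylor expansions of [f], [F] and [g] along [h = jacT x xi] are added with weights [1], [lam],
    [mu]. By [etaop_pairing] the first-order terms are the pairing of [xi] with [etaop], at most
    [K * delta * pnorm etaop]; everything else is of order [delta^2]. *)
Lemma lagrangian_lower_bound (C L rho K d M v : R) x (lam : H)
    (mu s : 'rV[R]_m) (xi : V) :
  let delta := pnorm (F x, \row_i (g i x + s 0 i)) in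
  0 < C -> 0 <= L -> 0 < K -> regular f F g x C L rho -> d <= 1 ->
  (1 + m%:R) * C * (K * d) <= rho -> C * (K * d) <= 2^-1 ->
  (forall i, 0 <= s 0 i) -> delta <= d ->
  pnorm xi <= K * delta -> F (x + jacT F g x xi) = 0 ->
  (forall i, g i (x + jacT F g x xi) =
     - Num.max (s 0 i + g i x ^+ 2 * xi.2 0 i) 0) ->
  v <= f (x + jacT F g x xi) -> pnorm (lam, mu) <= M ->
  v <= f x + inner lam (F x) + \sum_i mu 0 i * (g i x + s 0 i)
       + K * delta * pnorm (etaop f F g x lam mu)
       + ((1 + M + m%:R * M) * (L + 1) * ((1 + m%:R) * C * K) ^+ 2
          + m%:R * M * (4 * K)) * delta ^+ 2.
Proof.
move=> delta C0 L0 K0 [ff [FC FL] gCL] d1 c1 c2 s0 dd xiK Fx' gx' vf lmM.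
have gC i : op_le ('d (g i) x) C /\ `|g i x| <= C by have [[]] := gCL i.
have delta0 : 0 <= delta by exact: pnorm_ge0.
have delta1 : delta <= 1 by exact: le_trans d1.
have M0 : 0 <= M by exact: le_trans (pnorm_ge0 _) lmM.
set h := jacT F g x xi in Fx' gx' vf.
pose K1 := (1 + m%:R) * C.
have K10 : 0 <= K1 by rewrite mulr_ge0 ?addr_ge0// ltW.
have hK : `|h| <= K1 * K * delta.
  apply: le_trans (jacT_le Fd gd (ltW C0) FC gC xi) _.
  by rewrite -[leRHS]mulrA; apply: ler_wpM2l.
have hr : `|h| <= rho.
  apply: le_trans hK (le_trans _ c1); rewrite -/K1 mulrA; apply: ler_wpM2l => //.
  by rewrite mulr_ge0// ltW.
(* A common bound for all Taylor remainders. *)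
pose E := (L + 1) * (K1 * K) ^+ 2 * delta ^+ 2.
have E0 : 0 <= E.
  by apply: mulr_ge0; [apply: mulr_ge0; [exact: addr_ge0|exact: sqr_ge0]|exact: sqr_ge0].
have hE : (L + 1) * `|h| ^+ 2 <= E.
  rewrite /E -mulrA -exprMn; apply: ler_wpM2l; first by rewrite addr_ge0.
  by rewrite !expr2; apply: ler_pM.
have tf : f (x + h) <= f x + 'd f x h + E.
  have := le_trans (lipd_taylor fd L0 ff hr) hE.
  by rewrite ler_norml => /andP[_]; lra.
have lamM : `|lam| <= M by exact: le_trans (pnorm_fst (lam, mu)) lmM.
have muM i : `|mu 0 i| <= M by exact: le_trans (pnorm_coord (lam, mu) i) lmM.
have tF : - (M * E) <= inner lam (F x) + inner lam ('d F x h).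
  have := le_trans (lipd_taylor Fd L0 (conj FC FL) hr) hE.
  rewrite Fx' sub0r -opprD normrN -(ipDr (inner_formP H)) => FE.
  have := inner_CS lam (F x + 'd F x h); rewrite ler_norml => /andP[+ _].
  apply: le_trans; rewrite lerN2; exact: ler_pM.
have tg i : - (M * (E + 4 * K * delta ^+ 2)) <=
    mu 0 i * (g i x + s 0 i) + mu 0 i * ('d (g i) x h + g i x ^+ 2 * xi.2 0 i).
  have [glip _] := gCL i.
  have := le_trans (lipd_taylor (gd i) L0 glip hr) hE; rewrite gx'.
  have gsd : `|g i x + s 0 i| <= delta.
    by have := pnorm_coord (F x, \row_i (g i x + s 0 i)) i; rewrite mxE.
  have xid : `|xi.2 0 i| <= K * d.
    apply: le_trans (pnorm_coord xi i) (le_trans xiK _).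
    by apply: ler_wpM2l => //; exact: ltW.
  have Kd0 : `|0 : R| <= K * d by rewrite normr0 (le_trans _ xid).
  (* Taking one argument [0] compares the truncated slack with [s + g^2 nu] itself. *)
  have := relu_linear (s0 i) (gC i).2 gsd c2 xid Kd0.
  rewrite mulr0 addr0 subr0 [Num.max (s 0 i) 0]max_l//.
  set p := Num.max _ _ => h1 h2.
  have h3 : 4 * delta ^+ 2 * `|xi.2 0 i| <= 4 * K * delta ^+ 2.
    have : `|xi.2 0 i| <= K.
      apply: le_trans (pnorm_coord xi i) (le_trans xiK _).
      by rewrite -[leRHS]mulr1; apply: ler_wpM2l => //; exact: ltW.
    by have := sqr_ge0 delta; nra.
  have h4 : `|(g i x + s 0 i) + ('d (g i) x h + g i x ^+ 2 * xi.2 0 i)|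
      <= E + 4 * K * delta ^+ 2.
    have -> : (g i x + s 0 i) + ('d (g i) x h + g i x ^+ 2 * xi.2 0 i) =
      - (- p - g i x - 'd (g i) x h) - (p - s 0 i - g i x ^+ 2 * xi.2 0 i) by ring.
    apply: le_trans (ler_normB _ _) _; rewrite normrN lerD//.
    exact: le_trans h1 h3.
  rewrite -mulrDr; have := lexx `|mu 0 i * (g i x + s 0 i +
      ('d (g i) x h + g i x ^+ 2 * xi.2 0 i))|.
  rewrite {1}ler_norml => /andP[+ _]; apply: le_trans.
  by rewrite lerN2 normrM ler_pM.
have tgs : - (m%:R * (M * (E + 4 * K * delta ^+ 2))) <=
    \sum_i mu 0 i * (g i x + s 0 i)
    + \sum_i mu 0 i * ('d (g i) x h + g i x ^+ 2 * xi.2 0 i).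
  rewrite -big_split /=; apply: le_trans (ler_sum _ (fun i _ => tg i)).
  by rewrite sumr_const card_ord mulrC mulr_natr mulNrn.
have pair := etaop_pairing x lam mu xi; rewrite /= -/h in pair.
have := ip_le ipV xi (etaop f F g x lam mu); rewrite -pair -!/(pnorm _) => CS.
have xiE : pnorm xi * pnorm (etaop f F g x lam mu)
    <= K * delta * pnorm (etaop f F g x lam mu).
  by apply: ler_wpM2r => //; exact: pnorm_ge0.
(* The three summands are the errors of [f], of [F] and of the [m] inequalities. *)
have -> : ((1 + M + m%:R * M) * (L + 1) * ((1 + m%:R) * C * K) ^+ 2
   + m%:R * M * (4 * K)) * delta ^+ 2 =
   E + M * E + m%:R * (M * (E + 4 * K * delta ^+ 2)) by rewrite /E /K1; ring.
move: tgs xiE CS tF tf vf.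
set S1 := \sum_i _; set S2 := \sum_i _.
move: (m%:R * _) (M * E) (K * delta * _) (pnorm xi * _) => a1 a2 a3 a4; lra.
Qed.
End Comparison.

(** * The penalty functions near zero *)

Section Penalty.
Variables (R : realType) (phi : R -> \bar R).
Hypothesis phi_adm : phi_admissible phi.

Lemma edom_down s t : 0 <= s -> s <= t -> edom phi t -> edom phi s.
Proof.
move=> s0 st [t0 tfin]; split => //.
by apply: le_lt_trans tfin; exact: phi_nondecreasing.
Qed.

Lemma phi_fineK t : edom phi t -> (fine (phi t))%:E = phi t.
Proof.
move=> [t0 tfin]; apply: fineK; rewrite ge0_fin_numE//; exact: phi_ge0.
Qed.

Lemma phi_fin_near0 : exists2 t : R, 0 < t & edom phi t.
Proof.
case: (phi_coercive phi_adm) => [[-> _]|[a a0 [-> _]]].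
  by exists 1; rewrite //= in_itv/= ler01.
by exists (a / 2); rewrite ?divr_gt0//= in_itv/=; lra.
Qed.

(** By convexity and [phi 0 = 0] the quotient [phi t / t] is nondecreasing, and near [0] it exceeds
    half the derivative there. *)
Lemma phi_linear : phi_smooth phi ->
  exists2 k : R, 0 < k & forall t, edom phi t -> k * t <= fine (phi t).
Proof.
move=> [dphi [dP _ d0]].
have [t1 t10 t1dom] := phi_fin_near0.
have dom0 : edom phi 0 by apply: edom_down t1dom => //; exact: ltW.
have phi0 : fine (phi 0) = 0 by rewrite (phi_eq0 phi_adm (lexx 0)).2.
have /cvgrPdist_lt/(_ (dphi 0 / 2)) := dP 0 dom0.
have dh : 0 < dphi 0 / 2 by rewrite divr_gt0.
move=> /(_ dh)/nbhs_ballP[e /= e0 he].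
exists (dphi 0 / 2) => // t tdom; have [t0 _] := tdom.
have [->|tN0] := eqVneq t 0; first by rewrite mulr0 phi0.
have tp : 0 < t by rewrite lt_def tN0.
(* A point close enough to [0] for the difference quotient, and of the form
   [(s / t) * t + (1 - s / t) * 0] for convexity. *)
pose s := Num.min t (e / 2).
have s0 : 0 < s by rewrite lt_min tp divr_gt0.
have st : s <= t by rewrite ge_min lexx.
have sdom : edom phi s by apply: edom_down tdom => //; exact: ltW.
have := he s; rewrite /ball /= sub0r normrN gtr0_norm// => /(_ _)/wrap[].
  by rewrite gt_min; apply/orP; right; lra.
move=> /(_ _)/wrap[]; first by split => //; apply/eqP; rewrite gt_eqF.
rewrite phi0 !subr0 ltr_distlC => /andP[+ _].
rewrite ltr_pdivlMr// => h1.
have al : 0 <= s / t <= 1.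
  by rewrite divr_ge0 ?(ltW s0)//= ler_pdivrMr// mul1r.
have := phi_convex phi_adm t0 (lexx 0) al.
rewrite mulr0 addr0 divfK ?gt_eqF// -(phi_fineK sdom) -(phi_fineK tdom) -(phi_fineK dom0) -!EFinM -EFinD lee_fin.
rewrite phi0 mulr0 addr0 mulrAC ler_pdivlMr// => h2.
rewrite -(ler_pM2l s0); nra.
Qed.
End Penalty.

(** The expansion at [0] gives [psi y >= psi 0 - (|dpsi 0| + 1) |y|]. The constant [c] is larger by
    one, so that [|y| <= psi 0 / c] leaves at least [|y|], which is positive unless [y] has norm
    zero. *)
Lemma psi_near0 (R : realType) m (psi : 'rV[R]_m -> R) : psi_admissible psi ->
  exists2 w : R, 0 < w & forall y, orthant y -> enorm y <= w -> 0 < psi y.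
Proof.
move=> [[dpsi [dP _] _] _ psi0 _].
have o0 : orthant (0 : 'rV[R]_m) by move=> i; rewrite mxE.
have /nbhs_ballP[e /= e0 he] := dP 0 o0 1 ltr01.
pose c := enorm (dpsi 0) + 2.
have c0 : 0 < c by rewrite ltr_wpDl// enorm_ge0.
exists (Num.min (e / 2) (psi 0 / c)); first by rewrite lt_min !divr_gt0.
move=> y yo; rewrite le_min => /andP[y1 y2].
have := he y; rewrite /ball /= => /(_ _)/wrap[].
  split=> // i j; rewrite (ord1 i) /ball /= mxE sub0r normrN.
  by apply: le_lt_trans (le_enorm _ _) _; apply: le_lt_trans y1 _; lra.
move=> /(_ yo); rewrite subr0 mul1r ler_norml => /andP[h _].
have := ip_CS (vdot_formP R m) (dpsi 0) y; rewrite ler_norml => /andP[h2 _].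
rewrite -![ipn _ _]/(enorm _) in h2.
move: y2; rewrite ler_pdivlMr// /c => h3; have := enorm_ge0 y.
have [y0|y0] := eqVneq (enorm y) 0; first by move: h h2; rewrite y0; lra.
move=> yp; have : 0 < enorm y by rewrite lt_def y0.
lra.
Qed.

Lemma Omega_near (R : realType) (X H : hilbertType R) m (F : X -> H)
    (g : 'I_m -> X -> R) phi psi :
  phi_admissible phi -> psi_admissible psi ->
  exists2 w : R, 0 < w & forall x, `|F x| <= w -> enorm (gpos g x) <= w ->
    Omega F g phi psi x.
Proof.
move=> phia psia; have [w w0 wP] := psi_near0 psia.
have [t t0 tdom] := phi_fin_near0 phia.
(* The bound [1] gives [|F x|^2 <= |F x| <= t]. *)
exists (Num.min w (Num.min 1 t)); first by rewrite !lt_min w0 ltr01.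
move=> x; rewrite !le_min => /and3P[_ F1 Ft] /andP[gw _]; split.
  by apply: wP gw => i; rewrite mxE le_max lexx orbT.
apply: (edom_down phia _ _ tdom).2; first exact: sqr_ge0.
by have := normr_ge0 (F x); nra.
Qed.

(** * Uniform regularity near almost feasible, almost optimal points *)

Section Domain.
Variables (R : realType) (X H : hilbertType R) (m : nat).
Variables (f : X -> R) (F : X -> H) (g : 'I_m -> X -> R).
Variables (phi : R -> \bar R) (psi : 'rV[R]_m -> R).
Hypotheses (f_C1 : C1 f) (F_C1 : C1 F) (g_C1 : forall i, C1 (g i)).
Hypotheses (phi_adm : phi_admissible phi) (psi_adm : psi_admissible psi).
Hypothesis f_C2 : C2_on (Omega F g phi psi) f.
Hypothesis F_C2 : C2_on (Omega F g phi psi) F.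
Hypothesis g_C2 : forall i, C2_on (Omega F g phi psi) (g i).
Variables (r v eps : R).
Hypotheses (r0 : 0 < r) (eps0 : 0 < eps).
Local Notation D := (Omega_r f F g phi psi r (v + eps)).
Hypothesis f_bounded : bounded2_on D f.
Hypothesis F_bounded : bounded2_on D F.
Hypothesis g_bounded : forall i, bounded2_on D (g i).

Definition bounded2_at (Y : normedModType R) (G : X -> Y) (C : R) (x : X) :=
  [/\ `|G x| <= C, op_le ('d G x) C & bop_le (diff2 G x) C].

Lemma bounded2_at_mono (Y : normedModType R) (G : X -> Y) (C C' : R) x :
  C <= C' -> bounded2_at G C x -> bounded2_at G C' x.
Proof.
move=> CC' [G0 G1 G2]; split; first exact: le_trans CC'.
- by move=> h; apply: le_trans (G1 h) _; exact: ler_wpM2r.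
- by move=> h k; apply: le_trans (G2 h k) _; apply: ler_wpM2r => //; exact: ler_wpM2r.
Qed.

Lemma common_bound : exists2 C : R, 0 < C & forall x, D x ->
  [/\ bounded2_at f C x, bounded2_at F C x & forall i, bounded2_at (g i) C x].
Proof.
have [Cf fC] := f_bounded; have [CF FC] := F_bounded.
have [Cg gC] := choice g_bounded.
have s0 : 0 <= \sum_i `|Cg i| by exact: sumr_ge0.
exists (1 + `|Cf| + `|CF| + \sum_i `|Cg i|).
  by rewrite ltr_wpDr// ltr_wpDr// ltr_wpDr.
move=> x Dx; split=> [||i].
- apply: bounded2_at_mono (fC x Dx); have := ler_norm Cf; have := normr_ge0 CF; lra.
- apply: bounded2_at_mono (FC x Dx); have := ler_norm CF; have := normr_ge0 Cf; lra.
- apply: bounded2_at_mono (gC i x Dx).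
  have : `|Cg i| <= \sum_i `|Cg i| by rewrite (bigD1 i)//= lerDl; exact: sumr_ge0.
  have := ler_norm (Cg i); have := normr_ge0 Cf; have := normr_ge0 CF; lra.
Qed.

(** The total change of the data between [x] and [y]; when it is small, [y] stays in [D]. *)
Let u (x y : X) : R := `|F y - F x| + `|f y - f x| + \sum_i `|g i y - g i x|.

Let u_continuous x : continuous (u x).
Proof.
have c (Y : normedModType R) (G : X -> Y) : C1 G -> continuous (fun y => `|G y - G x|).
  move=> GC y; apply: cvg_norm; apply: cvgB; last exact: cvg_cst.
  exact: C1_continuous.
move=> y; apply: cvgD; first by apply: cvgD; exact: c.
apply: cvg_big => [|i _]; first exact: add_continuous.
exact: (c _ (g i) (g_C1 i) y).
Qed.

Let u_lipschitz (C : R) x y : op_le ('d f y) C -> op_le ('d F y) C ->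
  (forall i, op_le ('d (g i) y) C) ->
  \forall z \near y, u x z <= u x y + (2 + m%:R) * (C + 1) * `|z - y|.
Proof.
move=> fC FC gC.
have l (Y : normedModType R) (G : X -> Y) : C1 G -> op_le ('d G y) C ->
    \forall z \near y, `|G z - G x| <= `|G y - G x| + (C + 1) * `|z - y|.
  move=> [Gd _] GC; apply: filterS (op_le_lipschitz (Gd y) GC) => z Gz.
  rewrite -[G z - G x](subrKA (G y)) addrC.
  by apply: le_trans (ler_normD _ _) _; exact: lerD.
have lg : \forall z \near y, forall i,
    `|g i z - g i x| <= `|g i y - g i x| + (C + 1) * `|z - y|.
  by apply: filter_forall => i; exact: (l _ (g i) (g_C1 i) (gC i)).
near=> z.
have h1 : `|F z - F x| <= `|F y - F x| + (C + 1) * `|z - y|.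
  by near: z; exact: (l _ F F_C1 FC).
have h2 : `|f z - f x| <= `|f y - f x| + (C + 1) * `|z - y|.
  by near: z; exact: (l _ f f_C1 fC).
have h3 i : `|g i z - g i x| <= `|g i y - g i x| + (C + 1) * `|z - y|.
  by move: i; near: z.
have h4 := ler_sum (P := xpredT) (index_enum 'I_m) (fun i _ => h3 i).
rewrite big_split /= sumr_const card_ord -mulr_natl in h4.
rewrite /u; lra.
Unshelve. all: by end_near. Qed.

(** A bootstrap: derivative bounds are known only in [D]. As long as [u x <= a] on the segment its
    points lie in [D], where [u x] grows at rate at most [M], so it stays below [a] up to length
    [a / M]. *)
Lemma ball_in_domain : exists a rho : R, [/\ 0 < a, 0 < rho &
  forall x, `|F x| <= a -> enorm (gpos g x) <= a -> f x <= v + a ->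
  forall h, `|h| <= rho -> D (x + h)].
Proof.
have [w w0 wOmega] := Omega_near F g phi_adm psi_adm.
have [C C0 CD] := common_bound.
have m0 : 0 <= m%:R :> R by [].
near (0 : R)^'+ => a.
have a0 : 0 < a by near: a; exact: nbhs_right_gt.
have a1 : a <= 1 by near: a; exact: nbhs_right_le.
(* [a2] keeps nearby points in [Omega]; [a3] keeps the penalised value below [v + eps]. *)
have a2 : (2 + m%:R) * a <= w by near: a; exact: near_small.
have a3 : (2 + r * (4 + (1 + m%:R) ^+ 2)) * a <= eps by near: a; exact: near_small.
pose M := (2 + m%:R) * (C + 1).
have M0 : 0 < M by apply: mulr_gt0; [exact: ltr_wpDr|exact: addr_gt0].
exists a, (a / M); split => //; first by rewrite divr_gt0.
move=> x Fx gx fx h hr.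
have uD y : u x y <= a -> D y.
  move=> uy.
  have s0 : 0 <= \sum_i `|g i y - g i x| by exact: sumr_ge0.
  have n1 := normr_ge0 (F y - F x); have n2 := normr_ge0 (f y - f x).
  have Fy : `|F y| <= 2 * a.
    rewrite -[F y](subrK (F x)); apply: le_trans (ler_normD _ _) _.
    by move: uy; rewrite /u; lra.
  have fy : f y <= v + 2 * a.
    by have := ler_norm (f y - f x); move: uy; rewrite /u; lra.
  have gy : enorm (gpos g y) <= (1 + m%:R) * a.
    apply: le_trans (enorm_le_sum _) _.
    have gi i : `|gpos g y 0 i| <= `|g i y - g i x| + a.
      have p z : `|gpos g z 0 i| = Num.max (g i z) 0.
        by rewrite mxE ger0_norm// le_max lexx orbT.
      have := le_trans (le_enorm (gpos g x) i) gx; rewrite !p => gxa.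
      rewrite ge_max addr_ge0 ?(ltW a0)// andbT.
      have := ler_norm (g i y - g i x).
      have : g i x <= a by apply: le_trans gxa; rewrite le_max lexx.
      by lra.
    apply: le_trans (ler_sum _ (fun i _ => gi i)) _.
    rewrite big_split /= sumr_const card_ord -mulr_natl.
    by move: uy; rewrite /u; lra.
  split; first by apply: wOmega; [apply: le_trans a2|apply: le_trans gy _]; nra.
  have e0 := enorm_ge0 (gpos g y); have f0 := normr_ge0 (F y).
  have F2 : `|F y| ^+ 2 <= 4 * a by nra.
  have m1 : 0 <= 1 + m%:R :> R by rewrite addr_ge0.
  have g2 : enorm (gpos g y) ^+ 2 <= (1 + m%:R) ^+ 2 * a.
    have : enorm (gpos g y) ^+ 2 <= ((1 + m%:R) * a) ^+ 2.
      by rewrite !expr2; apply: ler_pM.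
    have : a ^+ 2 <= a by nra.
    by have := sqr_ge0 (1 + m%:R : R); rewrite exprMn; nra.
  have : r * (`|F y| ^+ 2 + enorm (gpos g y) ^+ 2) <= r * (4 * a + (1 + m%:R) ^+ 2 * a).
    by apply: ler_wpM2l; [exact: ltW|exact: lerD].
  lra.
apply: (uD); rewrite -[h]scale1r.
have /le_trans : u x (x + 1 *: h) <= M * (1 * `|h|).
  apply: segment_growth; last by rewrite ler01 lexx.
  - exact: u_continuous.
  - by rewrite /u !subrr !normr0 !add0r big1// => i _; rewrite subrr normr0.
  - move=> t /andP[t0 t1] ut.
    have /uD/CD[[_ f1 _] [_ F1 _] g1] : u x (x + t *: h) <= a.
      apply: le_trans ut _; rewrite mulrC -ler_pdivlMr//.
      by apply: le_trans hr; rewrite ler_piMl.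
    by apply: u_lipschitz => // i; have [] := g1 i.
by apply; rewrite mul1r mulrC -ler_pdivlMr.
Unshelve. all: by end_near. Qed.

(** The whole ball lies in [D], where second derivatives are bounded by [C]; [diff_lipschitz] then
    gives the Lipschitz constant [C + 1]. *)
Lemma regular_near : exists C a rho : R, [/\ 0 < C, 0 < a, 0 < rho &
  forall x, `|F x| <= a -> enorm (gpos g x) <= a -> f x <= v + a ->
  [/\ D x, `|f x| <= C & regular f F g x C (C + 1) rho]].
Proof.
have [C C0 CD] := common_bound; have [a [rho [a0 rho0 aD]]] := ball_in_domain.
exists C, a, rho; split => // x Fx gx fx.
have Dx : D x by rewrite -[x]addr0; apply: aD => //; rewrite normr0 ltW.
have [bf bF bg] := CD x Dx.
have lip (Y : normedModType R) (G : X -> Y) : C1 G -> C2_on (Omega F g phi psi) G ->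
    (forall x, D x -> bounded2_at G C x) -> lipd G x C (C + 1) rho.
  move=> G1 [G2 _] GC; split; first by have [] := GC x Dx.
  move=> h k hr.
  have GD t : 0 <= t <= 1 -> is_diff2 G (x + t *: h) (diff2 G (x + t *: h)) /\
      bop_le (diff2 G (x + t *: h)) C.
    move=> /andP[t0 t1]; have Dt : D (x + t *: h).
      by apply: aD => //; rewrite normrZ ger0_norm// (le_trans _ hr)// ler_piMl.
    by split; [apply: G2; have [] := Dt|have [] := GC _ Dt].
  have := diff_lipschitz G1 GD k (t := 1); rewrite ler01 lexx => /(_ isT).
  have -> : x + 1 *: h = x + h by rewrite scale1r.
  by rewrite mul1r.
split => //; first by have [] := bf.
split.
- by apply: (lip _ f f_C1 f_C2) => y /CD[].
- by apply: (lip _ F F_C1 F_C2) => y /CD[].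
- move=> i; have [gi _ _] := bg i; split=> //.
  by apply: (lip _ (g i) (g_C1 i) (g_C2 i)) => y /CD[_ _ /(_ i)].
Qed.
End Domain.

(** * Continuity and uniform coercivity of [qop] *)

Section Coercivity.
Variables (R : realType) (X H : hilbertType R) (m : nat).
Variables (f : X -> R) (F : X -> H) (g : 'I_m -> X -> R).
Hypotheses (f_C1 : C1 f) (F_C1 : C1 F) (g_C1 : forall i, C1 (g i)).
Local Notation V := (H * 'rV[R]_m)%type.
Let ipV := pdot_formP H m.
Let Fd x : differentiable F x := F_C1.1 x.
Let gd i x : differentiable (g i) x := (g_C1 i).1 x.

Lemma jac_bound x : exists2 C : R, 0 <= C &
  op_le ('d F x) C /\ forall i, op_le ('d (g i) x) C /\ `|g i x| <= C.
Proof.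
have [CF CF0 FC] := diff_op_le (Fd x).
have /choice[Cg gC] i : exists C : R, 0 < C /\ op_le ('d (g i) x) C.
  by have [C C0 CP] := diff_op_le (gd i x); exists C.
have s0 : 0 <= \sum_i (Cg i + `|g i x|).
  by apply: sumr_ge0 => i _; rewrite addr_ge0// ltW// (gC i).1.
have mono (Y : normedModType R) (T : X -> Y) (C C' : R) : C <= C' -> op_le T C -> op_le T C'.
  by move=> CC' TC h; apply: le_trans (TC h) _; exact: ler_wpM2r.
exists (CF + \sum_i (Cg i + `|g i x|)); first by rewrite addr_ge0// ltW.
split; first by apply: mono FC; rewrite lerDl.
move=> i; have : Cg i + `|g i x| <= \sum_i (Cg i + `|g i x|).
  rewrite [leRHS](bigD1 i)//= lerDl; apply: sumr_ge0 => j _.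
  by rewrite addr_ge0// ltW// (gC j).1.
have [Ci0 Ci] := gC i; have := normr_ge0 (g i x).
by move=> g0 h; split; [apply: mono Ci; lra|lra].
Qed.

(** Continuity of [qop] in operator norm, which transfers coercivity from a limit point to nearby
    points. *)
Lemma qop_continuous x (e : R) : 0 < e ->
  \forall y \near x, forall xi, pnorm (qop F g y xi - qop F g x xi) <= e * pnorm xi.
Proof.
move=> e0; have [C C0 [FC gC]] := jac_bound x.
pose N : R := 1 + m%:R; have N0 : 0 < N by rewrite ltr_pwDl.
pose K := N * C; have K0 : 0 <= K by rewrite mulr_ge0// ltW.
near (0 : R)^'+ => d.
have d0 : 0 < d by near: d; exact: nbhs_right_gt.
have d1 : d <= 1 by near: d; exact: nbhs_right_le.
(* The summands are the budgets for the change of [jac], of [jacT] and of [slack]; [d <= 1] is used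
   in the second. *)
have d2 : (N * K + (K + N) * N + N) * d <= e by near: d; exact: near_small.
have nF := F_C1.2 x d d0.
have ng : \forall y \near x, forall i, op_le (fun h => 'd (g i) y h - 'd (g i) x h) d.
  by apply: filter_forall => i; exact: ((g_C1 i).2 x d d0).
have ng2 : \forall y \near x, forall i, `|g i y ^+ 2 - g i x ^+ 2| <= d.
  apply: filter_forall => i.
  have gc := @C1_continuous _ _ _ (g i) (g_C1 i).
  have g2c : g i y ^+ 2 @[y --> x] --> g i x ^+ 2.
    by under eq_fun do rewrite expr2; rewrite expr2; apply: cvgM; exact: gc.
  have /cvgrPdist_le/(_ d d0) := g2c.
  by apply: filterS => y; rewrite distrC.
near=> y => xi.
have yF : op_le (fun h => 'd F y h - 'd F x h) d by near: y.
have yg : forall i, op_le (fun h => 'd (g i) y h - 'd (g i) x h) d by near: y.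
have yg2 : forall i, `|g i y ^+ 2 - g i x ^+ 2| <= d by near: y.
have cB (a c : V) i : (a - c).2 0 i = a.2 0 i - c.2 0 i by rewrite !mxE.
have jacd h : pnorm (jac F g y h - jac F g x h) <= N * d * `|h|.
  rewrite -mulrA; apply: pnorm_le_coord => [|i]; first exact: yF.
  by rewrite cB !jacE//; exact: yg.
have slackd : pnorm (slack g y xi - slack g x xi) <= N * d * pnorm xi.
  rewrite -mulrA; apply: pnorm_le_coord => [|i].
    by rewrite /= subr0 normr0 mulr_ge0 ?pnorm_ge0// ltW.
  by rewrite cB !slackE -mulrBr normrM mulrC ler_pM// pnorm_coord.
have xi0 := pnorm_ge0 xi.
set w := jacT F g y xi - jacT F g x xi.
(* Pairing [w] with itself moves the difference of adjoints onto the difference of [jac]. *)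
have wd : `|w| <= N * d * pnorm xi.
  have [->|wN0] := eqVneq `|w| 0; first by rewrite !mulr_ge0// ltW.
  have wp : 0 < `|w| by rewrite lt_def wN0/=.
  rewrite -(ler_pM2r wp) -expr2 -inner_norm {1}/w (ipBl (inner_formP X)).
  rewrite !jacT_inner// -(ipBr ipV).
  apply: le_trans (ip_le ipV _ _) _; rewrite -!/(pnorm _).
  by rewrite mulrAC [leRHS]mulrC; apply: ler_wpM2l.
have jTx : `|jacT F g x xi| <= K * pnorm xi by exact: jacT_le.
have jw : pnorm (jac F g y w) <= (N * d + K) * (N * d * pnorm xi).
  rewrite -[jac F g y w](subrK (jac F g x w)).
  apply: le_trans (ipn_triangle ipV _ _) _; rewrite -!/(pnorm _).
  apply: (@le_trans _ _ ((N * d + K) * `|w|)).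
    by rewrite mulrDl; apply: lerD (jacd w) _; exact: jac_le.
  by apply: ler_wpM2l => //; rewrite addr_ge0// mulr_ge0// ltW.
have qE : qop F g y xi - qop F g x xi =
    ((jac F g y (jacT F g x xi) - jac F g x (jacT F g x xi)) + jac F g y w)
    + (slack g y xi - slack g x xi).
  rewrite /qop opprD addrACA; congr (_ + _).
  have -> : jac F g y w = jac F g y (jacT F g y xi) - jac F g y (jacT F g x xi).
    by rewrite /w jacD jacN.
  by rewrite [RHS]addrC subrKA.
rewrite qE; apply: le_trans (ipn_triangle ipV _ _) _; rewrite -!/(pnorm _).
apply: le_trans (lerD (ipn_triangle ipV _ _) (lexx _)) _; rewrite -!/(pnorm _).
have j1 : pnorm (jac F g y (jacT F g x xi) - jac F g x (jacT F g x xi))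
    <= N * d * (K * pnorm xi).
  by apply: le_trans (jacd _) _; apply: ler_wpM2l => //; rewrite mulr_ge0// ltW.
apply: le_trans (ler_wpM2r xi0 d2).
apply: le_trans (lerD (lerD j1 jw) slackd) _.
have : (N * d + K) * (N * d * pnorm xi) <= (N + K) * (N * d * pnorm xi).
  apply: ler_wpM2r; first by rewrite !mulr_ge0// ltW.
  by rewrite lerD2r ler_piMr// ltW.
lra.
Unshelve. all: by end_near. Qed.

(** Positive definiteness says [2 a |xi|^2 <= |B xi|^2]; the constant [min 1 a] avoids a square
    root, as its square is at most [a]. *)
Lemma Q_posdef_qop x : Q_posdef F g x ->
  exists2 b : R, 0 < b & forall xi, b * pnorm xi <= pnorm (qop F g x xi).
Proof.
move=> [a a0 aQ]; exists (Num.min 1 a); first by rewrite lt_min ltr01.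
move=> xi; have := aQ xi.1 xi.2; rewrite Q_qop -pnorm_sqr.
have := pnorm_ge0 xi; have := pnorm_ge0 (qop F g x xi).
move: (pnorm xi) (pnorm _) => p q q0 p0 h.
have b0 : 0 < Num.min 1 a by rewrite lt_min ltr01.
have b1 : Num.min 1 a <= 1 by rewrite ge_min lexx.
have b2 : Num.min 1 a <= a by rewrite ge_min lexx orbT.
move: (Num.min 1 a) b0 b1 b2 => b b0 b1 b2.
rewrite leNgt; apply/negP => qb.
have : q ^+ 2 <= (b * p) ^+ 2 by rewrite !expr2; apply: ler_pM => //; exact: ltW.
have : 0 < b * p by exact: le_lt_trans qb.
rewrite pmulr_rgt0// => pp.
have : b ^+ 2 * p ^+ 2 <= a * p ^+ 2.
  by apply: ler_wpM2r; [exact: sqr_ge0|nra].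
rewrite exprMn; have : 0 < a * p ^+ 2 by rewrite mulr_gt0// exprn_gt0.
lra.
Qed.

Lemma global_solP x : (exists y, global_sol f F g y) ->
  feasible F g x -> f x <= optval f F g -> global_sol f F g x.
Proof.
move=> [y [yf ymin]] xf fx; split => // z zf.
apply: le_trans fx _; apply: le_trans (ymin z zf).
by apply: ge_inf; [exists (f y) => _ [t tf <-]; exact: ymin|exists y].
Qed.

Lemma optval_le x : (exists y, global_sol f F g y) ->
  feasible F g x -> optval f F g <= f x.
Proof.
move=> [y [yf ymin]] xf.
by apply: ge_inf; [exists (f y) => _ [t tf <-]; exact: ymin|exists x].
Qed.

Lemma amaxQ_le x (xi : V) (e : R) : 0 < pnorm xi ->
  pnorm (qop F g x xi) <= e * pnorm xi -> (amaxQ F g x <= (e ^+ 2)%:E)%E.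
Proof.
move=> xi0 h; pose z := (pnorm xi)^-1 *: xi.
have z1 : pnorm z = 1.
  by rewrite /pnorm (ipnZ ipV) ger0_norm ?invr_ge0 ?pnorm_ge0// mulVf// gt_eqF.
have qz : pnorm (qop F g x z) <= e.
  rewrite qop_Z// /pnorm (ipnZ ipV) ger0_norm ?invr_ge0 ?pnorm_ge0//.
  by rewrite ler_pdivrMl// mulrC.
apply: (@le_trans _ _ (Q F g x z.1 z.2)%:E).
  by apply: ereal_inf_lbound; exists z.1, z.2; rewrite -pnorm_sqr sqrtr_sqr z1 normr1.
rewrite lee_fin Q_qop; have := pnorm_ge0 (qop F g x z).
by move: (pnorm _) qz => p; nra.
Qed.

Lemma amaxQ_ge0 x : (0 <= amaxQ F g x)%E.
Proof.
apply: le_ereal_inf_tmp => _ [lam [mu [_ ->]]].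
by rewrite lee_fin (Q_qop F g x (lam, mu)) mulr_ge0 ?sqr_ge0.
Qed.

End Coercivity.

Section UniformCoercivity.
Variables (R : realType) (X H : hilbertType R) (m : nat).
Variables (f : X -> R) (F : X -> H) (g : 'I_m -> X -> R).
Hypotheses (f_C1 : C1 f) (F_C1 : C1 F) (g_C1 : forall i, C1 (g i)).
Hypothesis sol_exists : exists x, global_sol f F g x.
Hypothesis PS : Palais_Smale F g.
Hypothesis Q_pd : forall x, global_sol f F g x -> Q_posdef F g x.
Local Notation V := (H * 'rV[R]_m)%type.
Let ipV := pdot_formP H m.

(** If no constants worked, the choices [d = b = harmonic n] would yield a Palais-Smale sequence
    with nearly annihilated directions [xi n]. A subsequence converges to a feasible point of
    optimal value, where [qop] is coercive, and continuity of [qop] contradicts this. *)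
Lemma uniform_coercivity (A : set X) : bounded_set A ->
  exists d b : R, [/\ 0 < d, 0 < b &
    forall x, A x -> `|F x| <= d -> enorm (gpos g x) <= d ->
      f x <= optval f F g + d ->
      forall xi : V, b * pnorm xi <= pnorm (qop F g x xi)].
Proof.
move=> bA; apply: contrapT => noconst.
have bad (n : nat) : exists p : X * V, [/\ A p.1,
    `|F p.1| <= harmonic n, enorm (gpos g p.1) <= harmonic n,
    f p.1 <= optval f F g + harmonic n &
    pnorm (qop F g p.1 p.2) < harmonic n * pnorm p.2].
  have n0 : 0 < harmonic n :> R by exact: harmonic_gt0.
  apply: contrapT => none; apply: noconst.
  exists (harmonic n), (harmonic n); split => // x Ax Fx gx fx xi.
  by rewrite leNgt; apply/negP => lt; apply: none; exists (x, xi).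
have [p pP] := choice bad; pose u n := (p n).1; pose xi n := (p n).2.
have h0 : harmonic n @[n --> \oo] --> (0 : R) by exact: cvg_harmonic.
have ub : bounded_fun u.
  have [M [Mr MP]] := bA; exists M; split => // N MN n _.
  by apply: (MP N MN); have [] := pP n.
have u1 : `|F (u n)| + enorm (gpos g (u n)) @[n --> \oo] --> (0 : R).
  have h2 : harmonic n + harmonic n @[n --> \oo] --> (0 : R).
    by rewrite -[X in _ --> X]addr0; exact: cvgD.
  apply: squeeze_cvgr (cvg_cst 0) h2.
  by apply: nearW => n; have [_ F1 g1 _ _] := pP n; rewrite addr_ge0 ?enorm_ge0// lerD.
have xi0 n : 0 < pnorm (xi n).
  have [_ _ _ _ lt] := pP n; have := le_lt_trans (pnorm_ge0 _) lt.
  by rewrite pmulr_rgt0// harmonic_gt0.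
have u2 : amaxQ F g (u n) @[n --> \oo] --> 0%E.
  have h1 : harmonic n * harmonic n @[n --> \oo] --> (0 : R).
    by rewrite -[X in _ --> X](mulr0 0); exact: cvgM.
  have h2 : (harmonic n * harmonic n : R)%:E @[n --> \oo] --> 0%E.
    by apply/fine_cvgP; split; [exact: nearW|exact: h1].
  apply: squeeze_cvge (cvg_cst 0%E) h2.
  apply: nearW => n; rewrite amaxQ_ge0/=.
  have [_ _ _ _ /ltW qn] := pP n.
  by rewrite -expr2; apply: (amaxQ_le F_C1 (xi0 n)).
have [k kh ck] := PS ub u1 u2.
(* A strictly increasing [k] dominates the identity, so limits pass to the subsequence. *)
have kn n : (n <= k n)%N.
  by elim: n => // n IH; apply: leq_ltn_trans IH _; exact: kh.
have kc : k n @[n --> \oo] --> \oo.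
  by apply/cvgnyPge => N; exists N => // n /= Nn; exact: leq_trans (kn n).
have hk : harmonic (k n) @[n --> \oo] --> (0 : R) by exact: (cvg_comp _ _ kc h0).
set x := lim (u (k n) @[n --> \oo]).
have ux : u (k n) @[n --> \oo] --> x by exact: ck.
have lim_le (v : X -> R) (c : R) : continuous v ->
    (forall n, v (u n) <= c + harmonic n) -> v x <= c.
  move=> vc vn.
  have v1 : v (u (k n)) @[n --> \oo] --> v x by apply: continuous_cvg => //; exact: vc.
  have v2 : c + harmonic (k n) @[n --> \oo] --> c.
    by rewrite -[X in _ --> X]addr0; apply: cvgD => //; exact: cvg_cst.
  by apply: (ler_cvg_to v1 v2); exact: nearW.
have xF : F x = 0.
  apply/eqP; rewrite -normr_le0; apply: (lim_le (fun y => `|F y|)).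
    by move=> y; apply: cvg_norm; exact: C1_continuous.
  by move=> n; rewrite add0r; have [] := pP n.
have xg i : g i x <= 0.
  apply: lim_le => [|n]; first exact: (@C1_continuous _ _ _ (g i) (g_C1 i)).
  rewrite add0r; have [_ _ gn _ _] := pP n.
  apply: le_trans (le_trans (le_enorm _ i) gn); apply: le_trans (ler_norm _).
  by rewrite mxE le_max lexx.
have xf : f x <= optval f F g.
  apply: lim_le => [|n]; first exact: C1_continuous.
  by have [] := pP n.
have [b b0 bq] := Q_posdef_qop (Q_pd (global_solP sol_exists (conj xF xg) xf)).
have b2 : 0 < b / 2 by rewrite divr_gt0.
have near1 : \forall n \near \oo, forall zeta,
    pnorm (qop F g (u (k n)) zeta - qop F g x zeta) <= b / 2 * pnorm zeta.
  exact: ux _ (qop_continuous F_C1 g_C1 x b2).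
have near2 : \forall n \near \oo, harmonic (k n) < b / 2.
  have /cvgrPdist_lt/(_ _ b2) := hk; apply: filterS => n.
  by rewrite sub0r normrN ger0_norm ?harmonic_ge0.
have [n [n1 n2]] := filter_ex (filterI near1 near2).
(* The norm of [qop] at [x] on [xi] would be below [(b / 2 + b / 2) |xi|]: one half bounds [qop] at
   [u (k n)], the other the distance of the two operators. *)
have [_ _ _ _ lt] := pP (k n).
have n3 := n1 (xi (k n)); have := bq (xi (k n)).
rewrite -[qop F g x _](subKr (qop F g (u (k n)) (xi (k n)))) => h.
have hlt : harmonic (k n) * pnorm (xi (k n)) < b / 2 * pnorm (xi (k n)).
  by rewrite ltr_pM2r.
have := le_trans h (ipn_triangleB ipV _ _); apply/negP; rewrite -ltNge.
apply: lt_le_trans (ltr_leD (lt_trans lt hlt) n3) _.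
by rewrite -mulrDl -splitr.
Qed.
End UniformCoercivity.

(** * Lower bounds for the augmented Lagrangian and localisation of its low points *)

Section Exactness.
Variables (R : realType) (X H : hilbertType R) (m : nat).
Variables (f : X -> R) (F : X -> H) (g : 'I_m -> X -> R).
Variables (phi : R -> \bar R) (psi : 'rV[R]_m -> R).
Hypotheses (phi_adm : phi_admissible phi) (psi_adm : psi_admissible psi).
Local Notation V := (H * 'rV[R]_m)%type.
Local Notation Omega := (Omega F g phi psi).
Local Notation AL := (AL f F g phi psi).
Local Notation fs := (optval f F g).
Let ipV := pdot_formP H m.

(** The quantity [delta] of the overview. *)
Definition residual (x : X) (mu : 'rV[R]_m) (c : R) : R :=
  pnorm (F x, qvec g psi x mu c).

Lemma qvec_ge x mu c i : g i x <= qvec g psi x mu c 0 i.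
Proof. by rewrite mxE le_max lexx. Qed.

Lemma enorm_gpos_le x mu c : enorm (gpos g x) <= enorm (qvec g psi x mu c).
Proof.
apply: ler_wsqrtr; apply: ler_sum => i _; rewrite -!expr2.
have := qvec_ge x mu c i; rewrite [gpos g x 0 i]mxE.
move: (qvec _ _ _ _ _ _ _) (g i x) => q y yq; rewrite maxEle.
by case: ifPn => y0; [rewrite expr0n/= sqr_ge0|move: y0; rewrite -ltNge; nra].
Qed.

Lemma AL_Omega x lam mu c (v : R) : (AL x lam mu c <= v%:E)%E -> Omega x.
Proof. by rewrite /Defs.AL; case: asboolP. Qed.

(* [phi t >= k t], [b <= psi 0] and [p = b / (1 + |mu|^2)] make both penalty
   terms at least quadratic, with the weights [1 + |lam|^2], [1 + |mu|^2]. *)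
Lemma AL_lower_bound : phi_smooth phi ->
  exists2 k : R, 0 < k & forall x lam mu c (v : R), 0 < c ->
    (AL x lam mu c <= v%:E)%E ->
    f x + inner lam (F x) + vdot mu (qvec g psi x mu c) + Defs.eta f F g x lam mu
    + k * c * ((1 + `|lam| ^+ 2) * `|F x| ^+ 2
               + (1 + enorm mu ^+ 2) * enorm (qvec g psi x mu c) ^+ 2) <= v.
Proof.
move=> /(phi_linear phi_adm)[kp kp0 phik]; have psi0 := psi0_gt0 psi_adm.
(* [kp / 2] serves the term in [phi], and [1 / (2 psi 0)] the term in [q], through [b <= psi 0]. *)
exists (Num.min (kp / 2) ((2 * psi 0)^-1)).
  by rewrite lt_min divr_gt0// invr_gt0 mulr_gt0.
set k := Num.min _ _.
have k1 : k <= kp / 2 by rewrite ge_min lexx.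
have k2 : k <= (2 * psi 0)^-1 by rewrite ge_min lexx orbT.
move=> x lam mu c v c0 ALv; have [bx phix] := AL_Omega ALv.
move: ALv; rewrite /Defs.AL asboolT// lee_fin; apply: le_trans.
set q := qvec _ _ _ _ _; set P := fine _.
have hP : kp * `|F x| ^+ 2 <= P by apply: phik; split => //; exact: sqr_ge0.
have l0 : 0 <= c * (1 + `|lam| ^+ 2) by rewrite mulr_ge0 ?addr_ge0 ?sqr_ge0// ltW.
have h1 : k * c * ((1 + `|lam| ^+ 2) * `|F x| ^+ 2) <= c / 2 * (1 + `|lam| ^+ 2) * P.
  have -> : k * c * ((1 + `|lam| ^+ 2) * `|F x| ^+ 2) =
    c * (1 + `|lam| ^+ 2) * (k * `|F x| ^+ 2) by ring.
  have -> : c / 2 * (1 + `|lam| ^+ 2) * P = c * (1 + `|lam| ^+ 2) * (P / 2) by field.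
  apply: ler_wpM2l => //; have := sqr_ge0 `|F x|; nra.
have m1 : 0 < 1 + enorm mu ^+ 2 by rewrite ltr_wpDr// sqr_ge0.
have h2 : k * c * ((1 + enorm mu ^+ 2) * enorm q ^+ 2)
    <= c / (2 * pfun g psi x mu) * enorm q ^+ 2.
  have -> : c / (2 * pfun g psi x mu) = c * (1 + enorm mu ^+ 2) * (2 * bfun g psi x)^-1.
    by rewrite /pfun; field; rewrite !gt_eqF.
  have -> : k * c * ((1 + enorm mu ^+ 2) * enorm q ^+ 2) =
    c * (1 + enorm mu ^+ 2) * k * enorm q ^+ 2 by ring.
  apply: ler_wpM2r; first exact: sqr_ge0.
  apply: ler_wpM2l; first by rewrite mulr_ge0// ltW.
  apply: le_trans k2 _; rewrite lef_pV2 ?posrE ?mulr_gt0//.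
  rewrite ler_pM2l//; apply: psi_max0 => // i.
  by rewrite mxE le_max lexx orbT.
lra.
Qed.

(** Young's inequality absorbs both multiplier terms into the weighted penalties at a cost [1 / s],
    [s = k * c], leaving [f + (s / 2) delta^2 + eta <= fs + 1 / s]. For large [s] this places [x] in
    the set where [f] is bounded, so [eta] is bounded by a [B] independent of [a], and [delta] is
    small. *)
Lemma AL_localisation (r eps : R) : phi_smooth phi -> 0 < r -> 0 < eps ->
  bounded2_on (Omega_r f F g phi psi r (fs + eps)) f ->
  exists2 B : R, 0 <= B & forall a, 0 < a -> exists2 c1 : R, 0 < c1 &
    forall c, c1 <= c -> forall x lam mu, (AL x lam mu c <= fs%:E)%E ->
    [/\ Omega_r f F g phi psi r (fs + eps) x, residual x mu c <= a,
        f x <= fs + a & Defs.eta f F g x lam mu <= B].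
Proof.
move=> phis r0 eps0 [C fC]; have [k k0 kP] := AL_lower_bound phis.
pose B := `|fs| + `|C| + 1; have B0 : 0 < B by rewrite ltr_wpDl// addr_ge0.
exists B => [|a a0]; first exact: ltW.
(* The thresholds: [2 r] and [1 / eps] put [x] in [Omega_r], [1 / a] bounds the excess of [f], [1]
   makes [1 / s <= 1] in the definition of [B], and [2 B / a^2] bounds [delta]. *)
near (pinfty_nbhs R) => s1.
have s10 : 0 < s1 by near: s1; exact: nbhs_pinfty_gt.
have s1r : 2 * r <= s1 by near: s1; apply: nbhs_pinfty_ge; exact: num_real.
have s1e : eps^-1 <= s1 by near: s1; apply: nbhs_pinfty_ge; exact: num_real.
have s1a : a^-1 <= s1 by near: s1; apply: nbhs_pinfty_ge; exact: num_real.
have s11 : 1 <= s1 by near: s1; apply: nbhs_pinfty_ge; exact: num_real.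
have s1B : 2 * B / a ^+ 2 <= s1 by near: s1; apply: nbhs_pinfty_ge; exact: num_real.
exists (s1 / k); first by rewrite divr_gt0.
move=> c; rewrite ler_pdivrMr// => cs x lam mu ALx.
have c0 : 0 < c by rewrite -(pmulr_lgt0 _ k0); exact: lt_le_trans cs.
have := kP _ _ _ _ _ c0 ALx.
set q := qvec _ _ _ _ _ => h.
pose s := k * c; have ss1 : s1 <= s by rewrite /s mulrC.
have s0 : 0 < s by exact: lt_le_trans ss1.
have si : s^-1 <= s1^-1 by rewrite lef_pV2.
have young (t : R) : t <= s * t ^+ 2 / 2 + s^-1 / 2.
  have : 0 <= (s * t - 1) ^+ 2 / s by rewrite divr_ge0 ?sqr_ge0// ltW.
  have -> : (s * t - 1) ^+ 2 / s = s * t ^+ 2 - 2 * t + s^-1.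
    by field; rewrite gt_eqF.
  lra.
have e0 : 0 <= Defs.eta f F g x lam mu by rewrite eta_etaop mulr_ge0 ?sqr_ge0.
have y1 := young (`|lam| * `|F x|).
have y2 := young (enorm mu * enorm q).
have := inner_CS lam (F x); rewrite ler_norml => /andP[i1 _].
have := ip_CS (vdot_formP R m) mu q; rewrite ler_norml => /andP[i2 _].
rewrite -![ipn _ _]/(enorm _) in i2.
rewrite -/s in h; rewrite !exprMn in y1 y2.
have D2 : residual x mu c ^+ 2 = `|F x| ^+ 2 + enorm q ^+ 2 by exact: pnorm_sqr.
(* The parts of the penalties weighted by [|lam|^2] and [|mu|^2] pay for the pairings; the
   unweighted parts keep the [delta^2] term. *)
have key : f x + s / 2 * residual x mu c ^+ 2 + Defs.eta f F g x lam mu <= fs + s^-1.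
  have := mulr_ge0 (ltW s0) (sqr_ge0 (`|lam| * `|F x|)).
  have := mulr_ge0 (ltW s0) (sqr_ge0 (enorm mu * enorm q)).
  have := mulr_ge0 (ltW s0) (sqr_ge0 `|F x|).
  have := mulr_ge0 (ltW s0) (sqr_ge0 (enorm q)).
  rewrite !exprMn D2; lra.
have res0 : 0 <= s / 2 * residual x mu c ^+ 2.
  by rewrite mulr_ge0 ?sqr_ge0// divr_ge0// ltW.
have seps : s^-1 <= eps.
  by apply: le_trans si _; rewrite -[leRHS]invrK lef_pV2 ?posrE ?invr_gt0.
have sa : s^-1 <= a.
  by apply: le_trans si _; rewrite -[leRHS]invrK lef_pV2 ?posrE ?invr_gt0.
have s1' : s^-1 <= 1.
  by apply: le_trans si _; rewrite -[leRHS]invr1 lef_pV2 ?posrE.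
have Dx : Omega_r f F g phi psi r (fs + eps) x.
  split; first exact: AL_Omega ALx.
  have : r * (`|F x| ^+ 2 + enorm (gpos g x) ^+ 2) <= s / 2 * residual x mu c ^+ 2.
    rewrite D2; apply: ler_pM; [exact: ltW|by rewrite addr_ge0 ?sqr_ge0|lra|].
    rewrite lerD2l !expr2; have := enorm_gpos_le x mu c.
    by move=> ?; apply: ler_pM => //; exact: enorm_ge0.
  lra.
have [fx _ _] := fC x Dx.
have fxB : fs + s^-1 - f x <= B.
  move: fx; rewrite ler_norml => /andP[? _].
  by have := ler_norm fs; have := ler_norm C; rewrite /B; lra.
split => //; last by lra.
  rewrite -(@ler_pXn2r _ 2)// ?nnegrE ?pnorm_ge0//; last exact: ltW.
  have : s / 2 * residual x mu c ^+ 2 <= B by lra.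
  have : B <= s / 2 * a ^+ 2.
    have : 2 * B / a ^+ 2 <= s by exact: le_trans ss1.
    by rewrite ler_pdivrMr ?exprn_gt0//; lra.
  move=> h1 h2; have := le_trans h2 h1.
  by rewrite ler_pM2l// divr_gt0.
lra.
Unshelve. all: by end_near. Qed.
End Exactness.

(** * KKT points and global exactness *)

Lemma KKT_complementarity (R : realType) (X H : hilbertType R) (m : nat)
    (f : X -> R) (F : X -> H) (g : 'I_m -> X -> R) x lam mu i :
  KKT f F g x lam mu -> mu 0 i = 0 \/ g i x = 0.
Proof.
move=> [_ _ /(_ i)]; rewrite maxEle; case: ifP => _ h; [left|right] => //.
by apply/eqP; rewrite -oppr_eq0 h.
Qed.

Lemma KKT_eta0 (R : realType) (X H : hilbertType R) (m : nat) (f : X -> R)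
    (F : X -> H) (g : 'I_m -> X -> R) x lam mu :
  KKT f F g x lam mu -> Defs.eta f F g x lam mu = 0.
Proof.
move=> xK; have [gL _ _] := xK.
rewrite /Defs.eta gL linear0 normr0 expr0n/= mulr0 add0r big1 ?mulr0// => i _.
rewrite (innerC _ 0) (ip0l (inner_formP X)) add0r.
by case: (KKT_complementarity i xK) => ->; rewrite ?mulr0 ?expr0n/= ?mul0r ?expr0n.
Qed.

(** Complementarity gives [q = 0] and [eta = 0], and feasibility removes the terms in [F], so only
    [f x] remains. *)
Lemma AL_KKT (R : realType) (X H : hilbertType R) (m : nat) (f : X -> R)
    (F : X -> H) (g : 'I_m -> X -> R) (phi : R -> \bar R) (psi : 'rV[R]_m -> R)
    (x : X) (lam : H) (mu : 'rV[R]_m) (c : R) :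
  phi_admissible phi -> psi_admissible psi -> KKT f F g x lam mu -> 0 < c ->
  AL f F g phi psi x lam mu c = (f x)%:E.
Proof.
move=> phia psia xK c0; have [gL Fx gmu] := xK.
have g0 i : g i x <= 0 by rewrite -(gmu i) le_max lexx.
have mu0 i : 0 <= mu 0 i by rewrite -oppr_le0 -(gmu i) le_max lexx orbT.
have gp : gpos g x = 0 by apply/rowP => i; rewrite !mxE max_r.
have bx : 0 < bfun g psi x by rewrite /bfun gp; exact: psi0_gt0.
have phi0 : phi (`|F x| ^+ 2) = 0%E.
  by rewrite Fx normr0 expr0n/= (phi_eq0 phia (lexx 0)).2.
have Ox : Omega F g phi psi x by split => //; rewrite phi0 ltry.
have px : 0 < pfun g psi x mu by rewrite divr_gt0// ltr_wpDr// sqr_ge0.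
have q0 : qvec g psi x mu c = 0.
  apply/rowP => i; rewrite !mxE; case: (KKT_complementarity i xK) => ->.
    by rewrite mulr0 oppr0 max_r.
  rewrite max_l// oppr_le0; apply: mulr_ge0 => //; apply: mulr_ge0; last exact: ltW.
  by rewrite invr_ge0 ltW.
rewrite /AL asboolT// q0 (KKT_eta0 xK) phi0 Fx (innerC _ 0) (ip0l (inner_formP H)) /=.
have v0 : vdot mu 0 = 0 by rewrite (ipC (vdot_formP R m)) (ip0l (vdot_formP R m)).
have e0 : enorm (0 : 'rV[R]_m) = 0 by exact: (ipn0 (vdot_formP R m)).
by rewrite v0 e0 expr0n/= !mulr0 !addr0.
Qed.

Theorem theorem5p5 (R : realType) (X H : hilbertType R) (m : nat)
    (f : X -> R) (F : X -> H) (g : 'I_m -> X -> R)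
    (phi : R -> \bar R) (psi : 'rV[R]_m -> R)
    (f_C1 : C1 f) (F_C1 : C1 F) (g_C1 : forall i, C1 (g i))
    (phi_adm : phi_admissible phi) (psi_adm : psi_admissible psi)
    (sol_exists : exists x, global_sol f F g x)
    (KKT_exists : forall x, global_sol f F g x ->
       exists lam mu, KKT f F g x lam mu)
    (f_C2 : C2_on (Omega F g phi psi) f)
    (F_C2 : C2_on (Omega F g phi psi) F)
    (g_C2 : forall i, C2_on (Omega F g phi psi) (g i))
    (phi_C1 : phi_smooth phi)
    (AL_lsc : forall c : R, 0 < c ->
       weakly_seq_lsc (AL_triplet f F g phi psi c))
    (r eps : R) (r_gt0 : 0 < r) (eps_gt0 : 0 < eps)
    (Omega_r_bounded :
       bounded_set (Omega_r f F g phi psi r (optval f F g + eps)))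
    (f_bounded :
       bounded2_on (Omega_r f F g phi psi r (optval f F g + eps)) f)
    (F_bounded :
       bounded2_on (Omega_r f F g phi psi r (optval f F g + eps)) F)
    (g_bounded : forall i,
       bounded2_on (Omega_r f F g phi psi r (optval f F g + eps)) (g i))
    (PS : Palais_Smale F g)
    (Q_pd : forall x, global_sol f F g x -> Q_posdef F g x) :
  globally_exact f F g phi psi.
Proof.
have fd x : differentiable f x := f_C1.1 x.
have Fd x : differentiable F x := F_C1.1 x.
have gd i x : differentiable (g i) x := (g_C1 i).1 x.
have ipV := pdot_formP H m.
set fs := optval f F g in f_bounded F_bounded g_bounded Omega_r_bounded.
have [C [a1 [rho [C0 a10 rho0 reg]]]] := regular_near f_C1 F_C1 g_C1 phi_adm
  psi_adm f_C2 F_C2 g_C2 r_gt0 eps_gt0 f_bounded F_bounded g_bounded.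
have [a2 [b [a20 b0 coer]]] :=
  uniform_coercivity f_C1 F_C1 g_C1 sol_exists PS Q_pd Omega_r_bounded.
have L0 : 0 <= C + 1 by rewrite addr_ge0// ltW.
have [d [K [/andP[d0 d1] K0 dK1 dK2 rest]]] :=
  restoration f Fd gd C0 L0 rho0 b0.
have [B B0 loc] :=
  AL_localisation phi_adm psi_adm phi_C1 r_gt0 eps_gt0 f_bounded.
have [k k0 ALk] := AL_lower_bound f F g phi_adm psi_adm phi_C1.
(* Bounds the multipliers through [b |(lam, mu)| <= |etaop| + |jac (grad f)|]: [eta <= B] gives
   [|etaop| <= 1 + 2 B], and the last term bounds the second norm. *)
pose M := (1 + 2 * B + (1 + m%:R) * C * C) / b.
(* The [delta^2] coefficient of [lagrangian_lower_bound] for the Lipschitz constant [L = C + 1]. *)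
pose K2 := (1 + M + m%:R * M) * (C + 1 + 1) * ((1 + m%:R) * C * K) ^+ 2
           + m%:R * M * (4 * K).
have a0 : 0 < Num.min (Num.min a1 a2) d by rewrite !lt_min a10 a20.
have [c1 c10 locc] := loc _ a0.
(* The penalty must outweigh [K2], then [K^2] from the AM-GM inequality, and still leave
   [delta^2]. *)
pose c0 := Num.max c1 ((K2 + K ^+ 2 + 1) / k).
have c00 : 0 < c0 by rewrite lt_max c10.
have key c x lam mu : c0 <= c -> (AL f F g phi psi x lam mu c <= fs%:E)%E ->
    global_sol f F g x /\ KKT f F g x lam mu.
  rewrite ge_max => /andP[c1c]; rewrite ler_pdivrMr// mulrC => kc ALx.
  have cp : 0 < c by exact: lt_le_trans c1c.
  have [Dx] := locc c c1c x lam mu ALx.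
  set q := qvec g psi x mu c; rewrite /residual -/q; set delta := pnorm _.
  rewrite !le_min => /andP[/andP[da1 da2] dd] fx etaB.
  have fx1 : f x <= fs + a1 by apply: le_trans fx _; rewrite lerD2l !ge_min lexx.
  have fx2 : f x <= fs + a2.
    by apply: le_trans fx _; rewrite lerD2l !ge_min lexx orbT.
  have FxD : `|F x| <= delta by exact: (pnorm_fst (F x, q)).
  have gxD : enorm (gpos g x) <= delta.
    by apply: le_trans (enorm_gpos_le g psi x mu c) _; exact: (pnorm_snd (F x, q)).
  have [_ _ rx] := reg x (le_trans FxD da1) (le_trans gxD da1) fx1.
  have qb := coer x Dx (le_trans FxD da2) (le_trans gxD da2) fx2.
  have [[fC _] [FC _] gCL] := rx.
  have gC i : op_le ('d (g i) x) C /\ `|g i x| <= C by have [[]] := gCL i.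
  set e := pnorm (etaop f F g x lam mu).
  have e0 : 0 <= e by exact: pnorm_ge0.
  have etaE : Defs.eta f F g x lam mu = e ^+ 2 / 2 by rewrite eta_etaop mulrC.
  have etaopE l u : etaop f F g x l u = jac F g x (grad f x) + qop F g x (l, u).
    by rewrite /etaop gradL_jacT// jacD -addrA.
  have lmM : pnorm (lam, mu) <= M.
    rewrite /M ler_pdivlMr// mulrC; apply: le_trans (qb _) _.
    have -> : qop F g x (lam, mu) = etaop f F g x lam mu - jac F g x (grad f x).
      by rewrite etaopE addrC addKr.
    apply: le_trans (ipn_triangleB ipV _ _) _; apply: lerD.
      by rewrite -/(pnorm _) -/e; have := sqr_ge0 (e - 1); lra.
    apply: le_trans (jac_le gd FC gC _) _; apply: ler_wpM2l.
      by rewrite mulr_ge0 ?addr_ge0// ltW.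
    by apply: grad_le => //; exact: ltW.
  (* With this slack [g + s = q], so the residual in [restoration] is exactly [delta]. *)
  pose s : 'rV[R]_m := \row_i (q 0 i - g i x).
  have s0 i : 0 <= s 0 i by rewrite mxE subr_ge0 qvec_ge.
  have gsq i : g i x + s 0 i = q 0 i by rewrite mxE addrC subrK.
  have gsE : \row_i (g i x + s 0 i) = q by apply/rowP => i; rewrite mxE gsq.
  have deltaE : delta = pnorm (F x, \row_i (g i x + s 0 i)) by rewrite gsE.
  have dd' : pnorm (F x, \row_i (g i x + s 0 i)) <= d by rewrite -deltaE.
  have [xi [xiK Fx' gx']] := rest x rx qb s s0 dd'.
  have feas' : feasible F g (x + jacT F g x xi).
    by split => // i; rewrite gx' oppr_le0 le_max lexx orbT.
  have := lagrangian_lower_bound fd Fd gd C0 L0 K0 rx d1 dK1 dK2 s0 dd' xiK Fx'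
    gx' (optval_le sol_exists feas') lmM.
  rewrite -deltaE -/e -/K2.
  have -> : \sum_i mu 0 i * (g i x + s 0 i) = vdot mu q.
    by apply: eq_bigr => i _; rewrite gsq.
  move=> low; have := ALk x lam mu c fs cp ALx; rewrite -/q etaE => up.
  have delta2 : delta ^+ 2 = `|F x| ^+ 2 + enorm q ^+ 2 by exact: pnorm_sqr.
  have weights : delta ^+ 2 <= (1 + `|lam| ^+ 2) * `|F x| ^+ 2
      + (1 + enorm mu ^+ 2) * enorm q ^+ 2.
    have := mulr_ge0 (sqr_ge0 `|lam|) (sqr_ge0 `|F x|).
    have := mulr_ge0 (sqr_ge0 (enorm mu)) (sqr_ge0 (enorm q)).
    by rewrite delta2; lra.
  have kcw : (K2 + K ^+ 2 + 1) * delta ^+ 2 <= k * c * ((1 + `|lam| ^+ 2) * `|F x| ^+ 2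
      + (1 + enorm mu ^+ 2) * enorm q ^+ 2).
    apply: le_trans (ler_wpM2r (sqr_ge0 delta) kc) _.
    by apply: ler_wpM2l => //; rewrite mulr_ge0// ltW.
  (* AM-GM: [K delta e <= e^2 / 4 + K^2 delta^2] *)
  have amgm := sqr_ge0 (e / 2 - K * delta).
  (* Adding [low] and [up] cancels [f] and the multiplier terms, and AM-GM absorbs the mixed term
     into half of [eta]. *)
  have ed : e ^+ 2 / 4 + delta ^+ 2 <= 0 by lra.
  have d20 := sqr_ge0 delta; have e20 := sqr_ge0 e.
  have ez : e = 0 by apply/eqP; rewrite -sqrf_eq0; apply/eqP; lra.
  have dz : delta = 0 by apply/eqP; rewrite -sqrf_eq0; apply/eqP; lra.
  have [Fx0 q0] : F x = 0 /\ q = 0 by have [] := pnorm_eq0 dz.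
  have xfeas : feasible F g x.
    by split => // i; apply: le_trans (qvec_ge g psi x mu c i) _; rewrite -/q q0 mxE.
  have xsol : global_sol f F g x.
    have lF : inner lam (F x) = 0.
      by rewrite Fx0 innerC (ip0l (inner_formP H)).
    have muq : vdot mu q = 0.
      by rewrite q0 (ipC (vdot_formP R m)) (ip0l (vdot_formP R m)).
    apply: global_solP => //; rewrite -/fs; move: up kcw.
    by rewrite lF muq ez dz expr0n/=; lra.
  (* KKT multipliers [(l, u)] exist at [x] and also annihilate [etaop]; the difference to
     [(lam, mu)] lies in the kernel of [qop], which is zero by [qb]. *)
  split => //; have [l [u KKTx]] := KKT_exists x xsol.
  suff [-> ->] : (lam, mu) = (l, u) by [].
  have etau : etaop f F g x l u = 0.
    have := KKT_eta0 KKTx; rewrite eta_etaop => /eqP.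
    by rewrite mulf_eq0 invr_eq0 pnatr_eq0/= sqrf_eq0 => /eqP/pnorm_eq0.
  have := qb ((lam, mu) - (l, u)); rewrite qop_B//.
  have -> : qop F g x (lam, mu) - qop F g x (l, u) =
      etaop f F g x lam mu - etaop f F g x l u.
    by rewrite !etaopE [X in _ = X - _]addrC addrKA.
  rewrite etau subr0 -/e ez pmulr_rle0// => p0; apply/eqP; rewrite -subr_eq0.
  by apply/eqP/pnorm_eq0/le_anti; rewrite p0 pnorm_ge0.
exists c0 => // c cc x lam mu; have cp : 0 < c by exact: lt_le_trans cc.
have val y l u : global_sol f F g y -> KKT f F g y l u ->
    AL f F g phi psi y l u c = fs%:E.
  move=> ys yK; rewrite (AL_KKT phi_adm psi_adm yK cp); congr EFin.
  apply/le_anti; rewrite (optval_le sol_exists ys.1) andbT.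
  by apply: lb_le_inf; [exists (f y), y; [exact: ys.1|]|move=> _ [z zf <-]; exact: ys.2].
(* A minimiser has value at most [fs], since a KKT triplet at a solution attains [fs], and [key]
   applies. Conversely a triplet with a smaller value would by [key] be a KKT triplet at a solution,
   whose value is [fs]. *)
split=> [xmin|[xs xK] x' l' u'].
  have [y ys] := sol_exists; have [l [u yK]] := KKT_exists y ys.
  by apply: (key c) => //; rewrite -(val y l u).
rewrite (val x lam mu)// leNgt; apply/negP => lt.
have [x's x'K] := key c x' l' u' cc (ltW lt).
by move: lt; rewrite val// ltxx.
Qed.
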